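(* Let $r\ge 1$, let $p(t)=t(t-\alpha_1)\cdots(t-\alpha_r)=\sum_{i=1}^{r+1}a_it^i$ with $\alpha_1,\dots,\alpha_r$ pairwise distinct nonzero complex numbers (so $a_1\neq 0$ and $a_{r+1}=1$), and let $R=\mathbb C[t^{\pm1},u : u^2=p(t)]$. Let $\mathfrak g$ be a simple finite-dimensional Lie algebra over $\mathbb C$ with Killing form $(\cdot,\cdot)$. For $\mathbf a=(a_1,\dots,a_r)$ and $i,j\in\mathbb Z$ define $\psi_{ij}(\mathbf a)\in\Omega_R^1/dR$ by $$\psi_{ij}(\mathbf a)=\begin{cases}\displaystyle\sum_{k=1}^{r}P_{i+j-1,-k}\,\omega_k & \text{if } i+j\ge -r+1,\\[2mm] \displaystyle\sum_{k=1}^{r}Q_{-i-j+1,-k}\,\omega_k & \text{if } i+j<-r+1.\end{cases}$$ Then the universal central extension of the hyperelliptic Lie algebra $\mathfrak g\otimes R$ is the $\mathbb Z_2$-graded Lie algebra $\widehat{\mathfrak g}=\widehat{\mathfrak g}^0\oplus\widehat{\mathfrak g}^1$, where $$\widehat{\mathfrak g}^0=(\mathfrak g\otimes\mathbb C[t,t^{-1}])\oplus\mathbb C\omega_0,\qquad \widehat{\mathfrak g}^1=(\mathfrak g\otimes\mathbb C[t,t^{-1}]u)\oplus\bigoplus_{k=1}^{r}\mathbb C\omega_k,$$ with the elements $\omega_0,\dots,\omega_r$ central and with bracket, for $x,y\in\mathfrak g$ and $i,j\in\mathbb Z$, $$[x\otimes t^i,y\otimes t^j]=[x,y]\otimes t^{i+j}+\delta_{i+j,0}\,j\,(x,y)\,\omega_0,$$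 $$[x\otimes t^iu,y\otimes t^ju]=[x,y]\otimes t^{i+j}p(t)+(x,y)\sum_{k=1}^{r+1}\Bigl(j+\tfrac12k\Bigr)a_k\,\delta_{i+j,-k}\,\omega_0,$$ $$[x\otimes t^iu,y\otimes t^j]=[x,y]\otimes t^{i+j}u+j\,(x,y)\,\psi_{ij}(\mathbf a).$$
   Context: For a commutative $\mathbb C$-algebra $R$, $\Omega_R=\Omega^1_R$ is the module of Kähler differentials of $R$ over $\mathbb C$, $d:R\to\Omega_R$ is the universal derivation, $dR$ is the subspace of exact differentials, and $\overline{c\,da}$ is the class of $c\,da$ in $\Omega_R/dR$. The universal central extension of $\mathfrak g\otimes R$ (bracket $[x\otimes a,y\otimes b]=[x,y]\otimes ab$) is a central extension admitting a unique homomorphism (over $\mathfrak g\otimes R$) to every other central extension of $\mathfrak g\otimes R$. By Kassel it is $(\mathfrak g\otimes R)\oplus\Omega_R/dR$ with $\Omega_R/dR$ central and $[x\otimes a,y\otimes b]=[x,y]\otimes ab+(x,y)\overline{a\,db}$. Notation: $\omega_0=\overline{t^{-1}dt}$ and $\omega_k=\overline{t^{-k}u\,dt}$ for $1\le k\le r$; these form a basis of $\Omega_R/dR$ (Bremner). The polynomials $P_{k,i}=P_{k,i}(a_1,\dots,a_r)$, for $k\ge -r$ and $-r\le i\le -1$, are defined by $P_{l,i}=\delta_{l,i}$ for $-r\le l,i\le -1$ and, for $k\ge 0$, $$(2k+r+3)P_{k,i}=-\sum_{j=1}^{r}(3j+2k-2r)\,a_j\,P_{k-r+j-1,i}.$$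 The quantities $Q_{m,i}$, for $m\ge 1$ and $-r\le i\le -1$, are defined by $Q_{m,i}=\delta_{m,-i}$ for $1\le m\le r$ and, for $m\ge r+1$, $$(2m-3)\,a_1\,Q_{m,i}=\sum_{j=2}^{r+1}(3j-2m)\,a_j\,Q_{m-j+1,i}.$$ *)

(* Defs.v *)
From HB Require Import structures.
From mathcomp Require Import all_boot all_order all_algebra.
From mathcomp Require Import sesquilinear zify.
From mathcomp Require Export reals complex.

Set Implicit Arguments.
Unset Strict Implicit.
Unset Printing Implicit Defensive.

Import Order.TTheory GRing.Theory Num.Theory passmx.
Local Open Scope ring_scope.

Section Lie.
Variable K : fieldType.

Definition is_lie (L : lmodType K) (br : {bilinear L -> L -> L}) : Prop :=
  (forall x, br x x = 0) /\
  (forall x y z, br x (br y z) + br y (br z x) + br z (br x y) = 0).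

Definition lie_hom (L M : lmodType K) (brL : {bilinear L -> L -> L})
    (brM : {bilinear M -> M -> M}) (f : {linear L -> M}) : Prop :=
  forall x y, f (brL x y) = brM (f x) (f y).

(* An ideal of a finite-dimensional Lie algebra is in particular a subspace,
   hence a [{vspace g}]. *)
Definition simple_lie (g : vectType K) (br : {bilinear g -> g -> g}) : Prop :=
  [/\ is_lie br,
      exists x y, br x y != 0 &
      forall I : {vspace g}, (forall x y, y \in I -> br x y \in I) ->
        I = 0%VS \/ I = fullv].

Definition killing (g : vectType K) (br : {bilinear g -> g -> g}) (x y : g) : K :=
  let b := vbasis {:g} in \tr (mxof b b (linfun (br x \o br y))).

Definition central_extension (L : lmodType K) (brL : {bilinear L -> L -> L})
    (E : lmodType K) (brE : {bilinear E -> E -> E}) (pi : {linear E -> L}) : Prop :=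
  [/\ is_lie brE, lie_hom brE brL pi, (forall x, exists e, pi e = x) &
      forall z, pi z = 0 -> forall e, brE z e = 0].

Definition universal_central_extension (L : lmodType K)
    (brL : {bilinear L -> L -> L}) (E : lmodType K)
    (brE : {bilinear E -> E -> E}) (pi : {linear E -> L}) : Prop :=
  central_extension brL brE pi /\
  forall (F : lmodType K) (brF : {bilinear F -> F -> F}) (rho : {linear F -> L}),
    central_extension brL brF rho ->
    exists f : {linear E -> F},
      [/\ lie_hom brE brF f, (forall e, rho (f e) = pi e) &
          forall f' : {linear E -> F},
            lie_hom brE brF f' -> (forall e, rho (f' e) = pi e) -> f' =1 f].

(* [V] is the internal direct sum of the subspaces [V0] and [V1], and the
   bracket respects the degrees. *)
Definition Z2_graded (V : lmodType K) (br : {bilinear V -> V -> V})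
    (V0 V1 : V -> Prop) : Prop :=
  [/\ forall (c : K) x y, V0 x -> V0 y -> V0 (c *: x + y),
      forall (c : K) x y, V1 x -> V1 y -> V1 (c *: x + y),
      forall v, exists v0 v1, [/\ V0 v0, V1 v1 & v = v0 + v1],
      forall v, V0 v -> V1 v -> v = 0 &
      [/\ forall x y, V0 x -> V0 y -> V0 (br x y),
          forall x y, V0 x -> V1 y -> V1 (br x y),
          forall x y, V1 x -> V0 y -> V1 (br x y) &
          forall x y, V1 x -> V1 y -> V0 (br x y)]].

Definition lin_span (V : lmodType K) (S : V -> Prop) (v : V) : Prop :=
  exists n (c : 'I_n -> K) (s : 'I_n -> V),
    (forall i, S (s i)) /\ v = \sum_(i < n) c i *: s i.

End Lie.

Section Universal.
Variable K : fieldType.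

Definition is_tensor_product (V W T : lmodType K)
    (tens : {bilinear V -> W -> T}) : Prop :=
  forall (M : lmodType K) (b : {bilinear V -> W -> M}),
    exists f : {linear T -> M},
      (forall v w, f (tens v w) = b v w) /\
      forall f' : {linear T -> M}, (forall v w, f' (tens v w) = b v w) -> f' =1 f.

(* The Lie algebra [g (x) A], as a Lie bracket on a tensor product. *)
Definition is_current_lie (g : lmodType K) (br : {bilinear g -> g -> g})
    (A : comAlgType K) (T : lmodType K) (tens : {bilinear g -> A -> T})
    (brT : {bilinear T -> T -> T}) : Prop :=
  [/\ is_tensor_product tens, is_lie brT &
      forall x y a b, brT (tens x a) (tens y b) = tens (br x y) (a * b)].

Definition is_derivation (A : comAlgType K) (M : lmodType A) (D : A -> M) : Prop :=
  [/\ forall a b, D (a + b) = D a + D b,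
      forall a b, D (a * b) = a *: D b + b *: D a &
      forall c : K, D c%:A = 0].

Definition is_kaehler (A : comAlgType K) (Om : lmodType A) (d : A -> Om) : Prop :=
  is_derivation d /\
  forall (M : lmodType A) (D : A -> M), is_derivation D ->
    exists f : {linear Om -> M},
      (forall a, f (d a) = D a) /\
      forall f' : {linear Om -> M}, (forall a, f' (d a) = D a) -> f' =1 f.

(* [cls : Om -> H] is a [K]-linear quotient map with kernel [dA], so [H] is
   [Om / dA]; [K] acts on the [A]-module [Om] through [c |-> c%:A]. *)
Definition is_mod_exact (A : comAlgType K) (Om : lmodType A) (d : A -> Om)
    (H : lmodType K) (cls : Om -> H) : Prop :=
  [/\ forall (c : K) w w', cls (c%:A *: w + w') = c *: cls w + cls w',
      forall h, exists w, cls w = h &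
      forall w, cls w = 0 <-> exists a, w = d a].

End Universal.

Section Hyperelliptic.
Variable K : fieldType.

Definition hyper_poly (r : nat) (alpha : 'I_r -> K) : {poly K} :=
  'X * \prod_(i < r) ('X - (alpha i)%:P).

(* [A = K[t^{+-1}, u : u^2 = p(t)]], the commutative [K]-algebra with these
   generators and relations. *)
Definition is_hyper_ring (p : {poly K}) (A : comUnitAlgType K) (t u : A) : Prop :=
  [/\ t \is a GRing.unit, u ^+ 2 = horner_alg t p &
      forall (B : comAlgType K) (t1 s1 u1 : B),
        t1 * s1 = 1 -> u1 ^+ 2 = horner_alg t1 p ->
        exists f : {lrmorphism A -> B},
          [/\ f t = t1, f u = u1 &
              forall f' : {lrmorphism A -> B}, f' t = t1 -> f' u = u1 -> f' =1 f]].

(* [om 0] is the class of [t^{-1} dt], and [om k] that of [t^{-k} u dt] for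
   [k > 0]. *)
Definition om (A : comUnitAlgType K) (t u : A) (Om : lmodType A) (d : A -> Om)
    (H : lmodType K) (cls : Om -> H) (k : nat) : H :=
  if k is 0%N then cls (t^-1 *: d t) else cls ((t ^ (- k%:Z) * u) *: d t).

(* The two homogeneous components of [T * H], where [T] is [g (x) A] and [H] is
   [Om / dA]; the summand [g (x) K[t,t^{-1}] u] of [T] is spanned by the
   [x (x) t^i u]. *)
Section Components.
Variables (A : comUnitAlgType K) (t u : A) (Om : lmodType A) (d : A -> Om).
Variables (H : lmodType K) (cls : Om -> H).
Variables (g T : lmodType K) (tens : {bilinear g -> A -> T}) (r : nat).

Definition ghat0 (z : T * H) : Prop :=
  lin_span (fun v => exists x (i : int), v = tens x (t ^ i)) z.1 /\
  exists c : K, z.2 = c *: om t u d cls 0.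

Definition ghat1 (z : T * H) : Prop :=
  lin_span (fun v => exists x (i : int), v = tens x (t ^ i * u)) z.1 /\
  exists c : nat -> K, z.2 = \sum_(1 <= k < r.+1) c k *: om t u d cls k.

End Components.

(** The families [P_{k,i}] and [Q_{m,i}], evaluated at the coefficients [a]:
    the recursive step of each is iterated with enough fuel.  [PcoefE_lt0],
    [PcoefE_ge0], [QcoefE_le] and [QcoefE_gt] below are the defining recursions. *)

Variables (r : nat) (a : nat -> K).

Definition Pstep (i : int) (f : int -> K) (k : int) : K :=
  if k < 0 then (k == i)%:R else
  - (\sum_(1 <= j < r.+1)
      (3 * j%:Z + 2 * k - 2 * r%:Z)%:~R * a j * f (k - r%:Z + j%:Z - 1))
  / (2 * k + r%:Z + 3)%:~R.

Definition Pcoef (k i : int) : K := iter `|k|.+2 (Pstep i) (fun=> 0) k.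

Definition Qstep (i : int) (f : int -> K) (m : int) : K :=
  if m <= r%:Z then (m == - i)%:R else
  (\sum_(2 <= j < r.+2) (3 * j%:Z - 2 * m)%:~R * a j * f (m - j%:Z + 1))
  / ((2 * m - 3)%:~R * a 1%N).

Definition Qcoef (m i : int) : K := iter `|m|.+1 (Qstep i) (fun=> 0) m.

Definition psi (H : lmodType K) (w : nat -> H) (i j : int) : H :=
  if 1 - r%:Z <= i + j
  then \sum_(1 <= k < r.+1) Pcoef (i + j - 1) (- k%:Z) *: w k
  else \sum_(1 <= k < r.+1) Qcoef (1 - i - j) (- k%:Z) *: w k.

End Hyperelliptic.

Section Recursions.
Variables (K : numFieldType) (r : nat) (a : nat -> K) (i : int).

Let Pstep_ext (f g : int -> K) (k : int) :
  (forall k', k' < k -> f k' = g k') -> Pstep r a i f k = Pstep r a i g k.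
Proof.
move=> fg; rewrite /Pstep; case: ifP => // _.
suff -> : \sum_(1 <= j < r.+1)
    (3 * j%:Z + 2 * k - 2 * r%:Z)%:~R * a j * f (k - r%:Z + j%:Z - 1) =
  \sum_(1 <= j < r.+1)
    (3 * j%:Z + 2 * k - 2 * r%:Z)%:~R * a j * g (k - r%:Z + j%:Z - 1) by [].
by apply: eq_big_nat => j /andP[j0 jr]; rewrite fg //; lia.
Qed.

Let Piter_stable n n' (k : int) : k < n%:Z -> k < n'%:Z ->
  iter n.+1 (Pstep r a i) (fun=> 0) k = iter n'.+1 (Pstep r a i) (fun=> 0) k.
Proof.
elim: n n' k => [|n IHn] n' k kn kn'; rewrite !iterS.
  by rewrite /Pstep kn.
case: n' kn' => [|n'] kn'; first by rewrite /Pstep kn'.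
by apply: Pstep_ext => k' k'k; apply: IHn; lia.
Qed.

Lemma PcoefE_lt0 (k : int) : k < 0 -> Pcoef r a k i = (k == i)%:R.
Proof. by move=> k_lt0; rewrite /Pcoef iterS /Pstep k_lt0. Qed.

Lemma PcoefE_ge0 (k : int) : 0 <= k ->
  (2 * k + r%:Z + 3)%:~R * Pcoef r a k i =
  - \sum_(1 <= j < r.+1) (3 * j%:Z + 2 * k - 2 * r%:Z)%:~R * a j
                         * Pcoef r a (k - r%:Z + j%:Z - 1) i.
Proof.
move=> k_ge0.
have -> : Pcoef r a k i = Pstep r a i (fun k' => Pcoef r a k' i) k.
  rewrite {1}/Pcoef iterS; apply: Pstep_ext => k' k'k.
  case: (ltP k' 0) => [k'_lt0|k'_ge0].
    by rewrite PcoefE_lt0 // iterS /Pstep k'_lt0.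
  by apply: Piter_stable; lia.
rewrite /Pstep ltNge k_ge0 /= mulrC divfK // intr_eq0; lia.
Qed.

Let Qstep_ext (f g : int -> K) (m : int) :
  (forall m', m' < m -> f m' = g m') -> Qstep r a i f m = Qstep r a i g m.
Proof.
move=> fg; rewrite /Qstep; case: ifP => // _.
suff -> : \sum_(2 <= j < r.+2)
    (3 * j%:Z - 2 * m)%:~R * a j * f (m - j%:Z + 1) =
  \sum_(2 <= j < r.+2)
    (3 * j%:Z - 2 * m)%:~R * a j * g (m - j%:Z + 1) by [].
by apply: eq_big_nat => j /andP[j0 jr]; rewrite fg //; lia.
Qed.

Let Qiter_stable n n' (m : int) : m <= n%:Z -> m <= n'%:Z ->
  iter n.+1 (Qstep r a i) (fun=> 0) m = iter n'.+1 (Qstep r a i) (fun=> 0) m.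
Proof.
elim: n n' m => [|n IHn] n' m mn mn'; rewrite !iterS.
  by rewrite /Qstep; have -> : m <= r%:Z by lia.
case: n' mn' => [|n'] mn'.
  by rewrite /Qstep; have -> : m <= r%:Z by lia.
by apply: Qstep_ext => m' m'm; apply: IHn; lia.
Qed.

Lemma QcoefE_le (m : int) : m <= r%:Z -> Qcoef r a m i = (m == - i)%:R.
Proof. by move=> m_le; rewrite /Qcoef iterS /Qstep m_le. Qed.

Lemma QcoefE_gt (m : int) : (0 < r)%N -> a 1%N != 0 -> r%:Z < m ->
  (2 * m - 3)%:~R * a 1%N * Qcoef r a m i =
  \sum_(2 <= j < r.+2) (3 * j%:Z - 2 * m)%:~R * a j * Qcoef r a (m - j%:Z + 1) i.
Proof.
move=> r_gt0 a1 m_gt.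
have -> : Qcoef r a m i = Qstep r a i (fun m' => Qcoef r a m' i) m.
  rewrite {1}/Qcoef iterS; apply: Qstep_ext => m' m'm.
  have -> : `|m|%N = `|m|.-1.+1 :> nat by lia.
  case: (leP m' r%:Z) => [m'_le|m'_gt].
    by rewrite QcoefE_le // iterS /Qstep m'_le.
  by apply: Qiter_stable; lia.
rewrite /Qstep leNgt m_gt /= mulrC divfK // mulf_neq0 // intr_eq0; lia.
Qed.

End Recursions.

(* Main.v *)
From HB Require Import structures.
Require Import Defs.
From mathcomp Require Import all_boot all_order all_algebra spectral.
From mathcomp Require Import sesquilinear zify ring boolp functions.

Set Implicit Arguments.
Unset Strict Implicit.
Unset Printing Implicit Defensive.

Import Order.TTheory GRing.Theory Num.Theory passmx.
Local Open Scope ring_scope.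

(** The elements [t^n] and [t^n u] form a basis of [R], and [Omega_R] is generated by
    [dt] and [du] with [2 u du = p'(t) dt]. Modulo exact differentials only [t^-1 dt]
    survives among the [t^n dt], and [t^n du = - n t^(n-1) u dt]; the remaining
    relation, [t^i u (2 u du - p'(t) dt) = 0], reads
    [\sum_j (2 i + 3 j) a_j t^(i+j-1) u dt = 0] for every integer [i] ([ocls_rec]).
    Solved for its last term it is the recursion of the [P_(k,i)], solved for its
    first term that of the [Q_(m,i)]. So both families are halves of one sequence,
    the coordinates of [t^n u dt] on [omega_1, ..., omega_r] ([ocls_expand]), and
    [psi_(i,j)] is the class of [t^(i+j-1) u dt] ([psiE]). The three bracket formulas
    are then the evaluation of [kap x y *: cls (a *: d b)] on basis elements.

    The [omega_k] are independent because the dual linear forms exist ([om_dual]). A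
    linear form on [Omega_R / dR] is the same as a pairing [psi] on [R] which is
    antisymmetric and satisfies [psi a (b c) = psi (a b) c + psi (a c) b]
    ([cocycle_lift]: such a pairing is a derivation of [R] in the dual module of [R]).
    On the basis of [R] this amounts to a sequence of values satisfying the
    recurrence above ([hyper_functional]), and [P], [Q] provide them. The basis of
    [R] is obtained by evaluating at the points of the curve ([hyper_indep]).

    That the extension by [Omega_R / dR] is universal is Kassel's theorem
    ([kassel]), proved here for any commutative algebra [A]. In a central
    extension of [g (x) A] the bracket of two elements depends only on their images.
    This gives a [g]-equivariant linear section by the explicit formula
    [x (x) a |-> \sum_i [e_i (x) 1, [f_i, x] (x) a]] with dual bases [e], [f] for the
    Killing form ([casimir_section]). The cocycle measured by that section is
    [g]-invariant, so by Schur's lemma it is [kap x y *: psi a b], and the Jacobi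
    identity says that [psi] factors through [Omega_A / dA].

    This rests on the nondegeneracy of the Killing form of a simple algebra, that is
    on Cartan's criterion ([killing_neq0]). For [D = ad x] let [S] be the operator
    acting as the conjugate of [l] on the generalised eigenspace of [l]. It is a
    derivation of [g] ([conj_semisimple_part]). If the Killing form vanishes, this
    forces [tr (D S) = \sum |l|^2 = 0], so every [ad x] is nilpotent, which Engel's
    theorem forbids ([simple_not_nil]). *)

(** * Engel's theorem and ideals of a simple Lie algebra *)

(** In finite dimension a linearly closed predicate is a subspace: take a subspace
    of largest dimension inside it. This turns ideals and kernels given by
    formulas into [{vspace _}]s. *)
Lemma vspace_of_pred (K : fieldType) (V : vectType K) (P : V -> Prop) :
  P 0 -> (forall c x y, P x -> P y -> P (c *: x + y)) ->
  exists U : {vspace V}, forall x, x \in U <-> P x.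
Proof.
move=> P0 Plin.
pose Q m := `[< exists U : {vspace V}, (forall x, x \in U -> P x) /\ \dim U = m >].
have exQ : exists m, Q m.
  by exists 0%N; apply/asboolP; exists 0%VS; split; rewrite ?dimv0// => x; rewrite memv0 => /eqP->.
have Qub m : Q m -> (m <= \dim {:V})%N.
  by move=> /asboolP[U [_ <-]]; apply/dimvS/subvf.
case: (ex_maxnP exQ Qub) => m /asboolP[U [UP Um]] maxm.
exists U => x; split=> [/UP//|Px]; apply: contrapT => xU.
suff : (\dim (U + <[x]>) <= \dim U)%N.
  rewrite (geq_leqif (dimv_leqif_sup (addvSl _ _))) => /subvP /(_ x) xUx.
  by apply: xU; apply: xUx; rewrite memvE addvSr.
rewrite Um; apply: maxm; apply/asboolP; exists (U + <[x]>)%VS; split => // y.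
move=> /memv_addP[u uU [v /vlineP[c ->] ->]].
by rewrite addrC; apply: Plin => //; apply: UP.
Qed.

Section LieBasics.
Variables (K : fieldType) (g : lmodType K) (br : {bilinear g -> g -> g}).
Hypothesis brL : is_lie br.

Lemma lie_anti x y : br x y = - br y x.
Proof.
have := brL.1 (x + y); rewrite linearDl !linearDr /= !brL.1 add0r addr0.
by move=> /eqP; rewrite addr_eq0 => /eqP.
Qed.

Lemma lie_jac x y z : br (br x y) z = br x (br y z) - br y (br x z).
Proof.
have := brL.2 x y z; rewrite (lie_anti z (br x y)) (lie_anti z x) linearNr.
by move=> /eqP; rewrite subr_eq0 => /eqP <-.
Qed.

End LieBasics.

Section Engel.
Variables (K : fieldType) (g : vectType K) (br : {bilinear g -> g -> g}).
Hypothesis brL : is_lie br.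
Hypothesis brN : forall x y, exists k, iter k (br x) y = 0.

(** Engel's theorem for the adjoint action, stated for a pair [U < V] of [h]-stable
    subspaces so that no quotient has to be formed. Induction on [\dim h]: take a
    maximal proper subalgebra [k] of [h]. The pair [k < h] yields [x] outside [k]
    normalising [k], so that [h = k + <[x]>]. The vectors of [V] sent into [U] by
    [k] form a subspace stable under [x], and [x] is nilpotent. *)
Lemma engel_step (h U V : {vspace g}) :
  (forall x y, x \in h -> y \in h -> br x y \in h) ->
  (forall x y, x \in h -> y \in U -> br x y \in U) ->
  (forall x y, x \in h -> y \in V -> br x y \in V) ->
  (U <= V)%VS -> ~~ (V <= U)%VS ->
  exists v, [/\ v \in V, v \notin U & forall x, x \in h -> br x v \in U].
Proof.
have [n] := ubnP (\dim h); elim: n h U V => // n IHn h U V hn hh hU hV UV VU.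
have [h0|h_neq0] := eqVneq h 0%VS.
  have /subvPn[v vV vU] := VU; exists v; split=> // x.
  by rewrite h0 memv0 => /eqP ->; rewrite linear0l mem0v.
pose Q m := `[< exists k : {vspace g}, [/\ (k <= h)%VS, ~~ (h <= k)%VS,
  forall x y, x \in k -> y \in k -> br x y \in k & \dim k = m] >].
have exQ : exists m, Q m.
  exists 0%N; apply/asboolP; exists 0%VS; split; rewrite ?sub0v ?subv0 ?dimv0//.
  by move=> x y; rewrite !memv0 => /eqP-> _; rewrite linear0l.
have Qub m : Q m -> (m <= \dim {:g})%N.
  by move=> /asboolP[k [_ _ _ <-]]; apply/dimvS/subvf.
case: (ex_maxnP exQ Qub) => m /asboolP[k [kh hk kk km]] maxm.
have kn : (\dim k < n)%N.
  have := dimv_leqif_sup kh; move=> /ltn_leqif; rewrite hk => dk.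
  by apply: leq_trans dk _; rewrite -ltnS.
have [x [xh xk kx]] := IHn k k h kn kk kk (fun x y xk yh => hh x y (subvP kh _ xk) yh) kh hk.
have hE : (h <= k + <[x]>)%VS.
  apply/contraT => nh; suff : (\dim (k + <[x]>) <= \dim k)%N.
    rewrite (geq_leqif (dimv_leqif_sup (addvSl _ _))) => /subvP /(_ x) xUx.
    by move: xk; rewrite xUx// memvE addvSr.
  rewrite km; apply: maxm; apply/asboolP; exists (k + <[x]>)%VS; split=> //.
    by rewrite subv_add kh -memvE.
  move=> _ _ /memv_addP[y yk [_ /vlineP[c ->] ->]] /memv_addP[z zk [_ /vlineP[e ->] ->]].
  apply: (subvP (addvSl _ _)).
  rewrite linearDl !linearDr /= !linearZl_LR /= !linearZr_LR /= brL.1 !scaler0 addr0.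
  rewrite (lie_anti brL x z) scalerN.
  by apply: rpredB; [apply: rpredD; [exact: kk|apply/memvZ/kx]|apply/memvZ/kx].
have [W WP] : exists W : {vspace g}, forall v, v \in W <->
    v \in V /\ (forall y, y \in k -> br y v \in U).
  apply: vspace_of_pred => [|c v w [vV kv] [wV kw]].
    by split=> [|y _]; rewrite ?linear0r mem0v.
  split=> [|y yk]; first by rewrite memvD ?memvZ.
  by rewrite linearPr memvD ?memvZ ?kv ?kw.
have UW : (U <= W)%VS.
  apply/subvP => v vU; apply/WP; split; first exact: (subvP UV).
  by move=> y yk; apply: hU => //; apply: (subvP kh).
have xW v : v \in W -> br x v \in W.
  move=> /WP[vV kv]; apply/WP; split=> [|y yk]; first exact: hV.
  have -> : br y (br x v) = br (br y x) v + br x (br y v).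
    by rewrite (lie_jac brL) subrK.
  by apply: memvD; [apply: kv; exact: kx|apply: hU => //; exact: kv].
have kU y v : y \in k -> v \in U -> br y v \in U.
  by move=> yk vU; apply: hU => //; apply: (subvP kh).
have kV y v : y \in k -> v \in V -> br y v \in V.
  by move=> yk vU; apply: hV => //; apply: (subvP kh).
have [v [vV vU kv]] := IHn k U V kn kk kU kV UV VU.
have iW i : iter i (br x) v \in W.
  by elim: i => [|i IH]; [apply/WP | rewrite iterS xW].
have exi : exists i, iter i (br x) v \in U.
  by have [i vi] := brN x v; exists i; rewrite vi mem0v.
(* the last iterate of [v] under [x] outside [U] *)
case: (ex_minnP exi) => -[|i] iU imin; first by rewrite iU in vU.
exists (iter i (br x) v); split.
- by have /WP[] := iW i.
- by apply/negP => /imin; rewrite ltnn.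
move=> y /(subvP hE) /memv_addP[z zk [_ /vlineP[c ->] ->]].
rewrite linearDl /= linearZl_LR /= memvD ?memvZ//.
by have /WP[_ ->] := iW i.
Qed.

End Engel.

Section SimpleIdeals.
Variables (K : fieldType) (g : vectType K) (br : {bilinear g -> g -> g}).
Hypothesis hg : simple_lie br.

Let brL : is_lie br. Proof. by case: hg. Qed.

Lemma simple_ideal (P : g -> Prop) :
  P 0 -> (forall c x y, P x -> P y -> P (c *: x + y)) ->
  (forall x y, P y -> P (br x y)) -> (exists2 x, P x & x != 0) ->
  forall x, P x.
Proof.
move=> P0 Pl Pi [z Pz z0]; have [I IP] := vspace_of_pred P0 Pl.
have [_ _ /(_ I)] := hg.
case=> [x y yI|I0|I1 x]; first by apply/IP/Pi/IP.
- by move/IP: Pz; rewrite I0 memv0 (negPf z0).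
- by apply/IP; rewrite I1 memvf.
Qed.

(** [[g, g] = g], as an induction principle: a linearly closed predicate true on
    brackets is itself an ideal, since it holds on every [br x y]. *)
Lemma simple_perfect (P : g -> Prop) :
  (forall c x y, P x -> P y -> P (c *: x + y)) ->
  (forall x y, P (br x y)) -> forall x, P x.
Proof.
move=> Pl Pb; apply: simple_ideal => //.
- by rewrite -(brL.1 0).
- by have [_ [x [y xy]] _] := hg; exists (br x y).
Qed.

(** Were all [ad x] nilpotent, Engel's theorem for [0 < g] would give a nonzero
    central vector, and the centre would be all of [g]. *)
Lemma simple_not_nil : ~ (forall x y, exists k, iter k (br x) y = 0).
Proof.
move=> brN; have [_ [x0 [y0 xy]] _] := hg.
have gN0 : ~~ (fullv <= (0%VS : {vspace g}))%VS.
  apply/negP => /subvP /(_ (br x0 y0) (memvf _)).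
  by rewrite memv0 (negPf xy).
have [|||v [_ v0 bv]] := engel_step brL brN (h := fullv) _ _ _ (sub0v fullv) gN0.
- by move=> x y _ _; rewrite memvf.
- by move=> x y _; rewrite !memv0 => /eqP->; rewrite linear0r.
- by move=> x y _ _; rewrite memvf.
have bv0 x : br x v = 0 by apply/eqP; rewrite -memv0; apply/bv/memvf.
have cen : forall y, forall x, br x y = 0.
  apply: simple_ideal.
  - by move=> x; rewrite linear0r.
  - by move=> c x y hx hy z; rewrite linearPr hx hy scaler0 addr0.
  - by move=> x y hy z; rewrite !hy linear0r.
  - by exists v => //; rewrite -memv0.
by rewrite cen eqxx in xy.
Qed.

End SimpleIdeals.

(** * Complex conjugation of the eigenvalues of a matrix *)

(** Chinese remaindering at the points of [s], to order [m] at each of them. *)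
Lemma crt_poly (K : fieldType) (s : seq K) (c : K -> K) m : uniq s ->
  exists q : {poly K}, forall a, a \in s -> ('X - a%:P) ^+ m %| q - (c a)%:P.
Proof.
elim: s => [|a s IHs] /=; first by exists 0.
case/andP=> as_ us; have [q qP] := IHs us.
pose P := \prod_(b <- s) ('X - b%:P) ^+ m.
have coP : coprimep P (('X - a%:P) ^+ m).
  rewrite coprimep_sym /P; elim: (s) as_ => [|b s' IH]; first by rewrite big_nil coprimep1.
  rewrite inE negb_or big_cons => /andP[ab as'].
  rewrite coprimepMr IH// andbT coprimep_expl// coprimep_expr// coprimep_XsubC2//.
  by rewrite subr_eq0 eq_sym.
have [[e f] /= ef] := Bezout_eq1_coprimepP _ _ coP.
exists (q + P * (e * ((c a)%:P - q))) => b; rewrite inE => /predU1P[->|bs].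
  have -> : q + P * (e * ((c a)%:P - q)) - (c a)%:P
      = ((q - (c a)%:P) * f) * ('X - a%:P) ^+ m.
    rewrite -(mul1r ((q - (c a)%:P) * f * _)) -mulrA.
    have -> : f * ('X - a%:P) ^+ m = 1 - e * P by rewrite -ef addrAC subrr add0r.
    by ring.
  exact: dvdp_mulIr.
rewrite addrAC dvdp_add ?qP// dvdp_mulr//.
by rewrite /P (big_rem b)//= dvdp_mulIl.
Qed.

Section TrigPoly.
Variables (R : comNzRingType) (n : nat).
Implicit Types A B : 'M[R]_n.+1.

Lemma trig_mulmx A B : is_trig_mx A -> is_trig_mx B ->
  is_trig_mx (A *m B) /\ forall i, (A *m B) i i = A i i * B i i.
Proof.
move=> /is_trig_mxP tA /is_trig_mxP tB; split.
  apply/is_trig_mxP => i j ij; rewrite mxE big1// => k _.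
  have [ik|ki] := ltnP i k; first by rewrite tA ?mul0r.
  by rewrite tB ?mulr0// (leq_ltn_trans ki).
move=> i; rewrite mxE (bigD1 i)//= big1 ?addr0// => k ki.
have [ik|] := ltnP i k; first by rewrite tA ?mul0r.
by rewrite leq_eqVlt (negPf (ki : k != i :> nat)) /= => ki'; rewrite tB ?mulr0.
Qed.

Lemma trig_horner A p : is_trig_mx A ->
  is_trig_mx (horner_mx A p) /\ forall i, (horner_mx A p) i i = p.[A i i].
Proof.
move=> tA; elim/poly_ind: p => [|p c [tp dp]].
  by rewrite rmorph0 mx0_is_trig; split=> // i; rewrite horner0 mxE.
rewrite rmorphD rmorphM /= horner_mx_X horner_mx_C.
have [tpA dpA] := trig_mulmx tp tA; split.
  apply/is_trig_mxP => i j ij; rewrite mxE (is_trig_mxP tpA)// add0r mxE.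
  by rewrite -val_eqE ltn_eqF.
by move=> i; rewrite mxE dpA dp !hornerE mxE eqxx mulr1n.
Qed.

End TrigPoly.

Section ConjPart.
Variables (K : numClosedFieldType).

Section Derivation.
Variables (n : nat) (D : 'M[K]_n.+1).
Variable b : {bilinear 'rV[K]_n.+1 -> 'rV[K]_n.+1 -> 'rV[K]_n.+1}.
Hypothesis bD : forall y z, b y z *m D = b (y *m D) z + b y (z *m D).

(** The binomial argument for generalised eigenspaces: [D - (l + m)] acts on
    [b y z] through [D - l] on [y] or [D - m] on [z], so after [k1 + k2] steps one of
    the two factors is killed. *)
Lemma geigen_derivation l m k1 k2 y z :
  y *m (D - l%:M) ^+ k1 = 0 -> z *m (D - m%:M) ^+ k2 = 0 ->
  b y z *m (D - (l + m)%:M) ^+ (k1 + k2) = 0.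
Proof.
move: (erefl (k1 + k2)%N); move: {1}(k1 + k2)%N => c.
elim: c k1 k2 y z => [|c IH] [|k1] [|k2] y z ck //; rewrite ?expr0 ?mulmx1.
- by move=> -> _; rewrite linear0l.
- by move=> -> _; rewrite linear0l mul0mx.
- by move=> _ ->; rewrite linear0r mul0mx.
move=> y0 z0.
have -> : b y z *m (D - (l + m)%:M) ^+ (k1.+1 + k2.+1) =
    b (y *m (D - l%:M)) z *m (D - (l + m)%:M) ^+ (k1 + k2.+1)
    + b y (z *m (D - m%:M)) *m (D - (l + m)%:M) ^+ (k1.+1 + k2).
  rewrite addSn exprS [in RHS]addSnnS -mulmxDl.
  rewrite [X in _ *m X = _](_ : _ = (D - (l + m)%:M)
    *m (D - (l + m)%:M) ^+ (k1 + k2.+1)) //.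
  rewrite mulmxA; congr (_ *m _).
  rewrite !mulmxBr bD !mul_mx_scalar linearBl /= linearBr /= linearZl_LR linearZr_LR /=.
  by rewrite scalerDl opprD addrACA.
rewrite !IH ?addr0//; try by move: ck; lia.
all: by rewrite -mulmxA -[X in _ *m X](exprS (D - _)).
Qed.

End Derivation.

(** [S] is the polynomial in [D] that acts on the generalised eigenspace of
    eigenvalue [l] as the scalar [l^*]. As conjugation is additive and the product
    of the eigenspaces of [l] and [m] lies in that of [l + m], [S] is a derivation of
    every product of which [D] is one. In a triangular form of [D] the trace of
    [D *m S] is the sum of the [`|l| ^+ 2], so it vanishes only if [D] is nilpotent. *)
Lemma conj_semisimple_part n (D : 'M[K]_n) : exists S : 'M[K]_n,
  (\tr (D *m S) = 0 -> D ^+ n = 0) /\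
  forall b : {bilinear 'rV[K]_n -> 'rV[K]_n -> 'rV[K]_n},
    (forall y z, b y z *m D = b (y *m D) z + b y (z *m D)) ->
    (forall y z, b y z *m S = b (y *m S) z + b y (z *m S)).
Proof.
case: n D => [|n] D.
  exists 0; split=> [_|b _ y z]; first by apply/matrixP => -[].
  by apply/matrixP => i [].
have [P /unitarymx_unit uP tP] := Schur D (ltn0Sn n).
rewrite /similar_to conjumx // in tP.
set T := P *m D *m invmx P in tP.
have DE : D = invmx P *m T *m P by rewrite /T !mulmxA mulVmx// mul1mx mulmxKV.
have uP' : P \is a GRing.unit by [].
have horD p : horner_mx D p = invmx P *m horner_mx T p *m P.
  by rewrite DE horner_mx_uconjC.
pose ev := [seq T i i | i : 'I_n.+1].
(* [q] must be right at the sums of eigenvalues too, eigenvalues or not: there the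
   bracket of two generalised eigenvectors lives. *)
pose s := undup (ev ++ [seq x + y | x <- ev, y <- ev]).
have Tev i : T i i \in ev by apply/mapP; exists i; rewrite ?mem_enum.
have evs x : x \in ev -> x \in s by rewrite mem_undup mem_cat => ->.
pose e := undup ev.
pose p_ (i : 'I_(size e)) : {poly K} := ('X - (e`_i)%:P) ^+ n.+1.
have full : (1%:M <= \sum_i kermxpoly D (p_ i))%MS.
  have cop : {in xpredT &, forall i j, j != i -> coprimep (p_ i) (p_ j)}.
    move=> i j _ _ ji; rewrite coprimep_expl// coprimep_expr// coprimep_XsubC2//.
    by rewrite subr_eq0 nth_uniq ?undup_uniq.
  rewrite -(kermxpoly_prod D cop).
  rewrite /kermxpoly; apply/sub_kermxP; rewrite mul1mx.
  have : char_poly T %| \prod_i p_ i.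
    rewrite char_poly_trig// /p_ prodrXl.
    have -> : (\prod_(i < size e) ('X - (e`_i)%:P)) ^+ n.+1 =
        \prod_(i < n.+1) \prod_(a <- e) ('X - a%:P).
      by rewrite prodr_const cardT size_enum_ord (big_nth 0) big_mkord.
    apply: (big_ind2 (fun p q : {poly K} => p %| q)); rewrite ?dvdpp//.
      by move=> ? ? ? ? ? ?; apply: dvdp_mul.
    by move=> i _; rewrite dvdp_XsubCl root_prod_XsubC mem_undup Tev.
  case/dvdpP => r ->; rewrite rmorphM /= [horner_mx D (char_poly T)]horD Cayley_Hamilton.
  by rewrite mulmx0 mul0mx mulr0.
have [q qP] := @crt_poly K s Num.conj (n.+1 + n.+1) (undup_uniq _).
have hkill (v : 'rV_n.+1) p p' : v *m horner_mx D p = 0 -> p %| p' -> v *m horner_mx D p' = 0.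
  move=> v0 /dvdpP[r ->]; rewrite mulrC rmorphM /=.
  by rewrite -[_ * _]/(_ *m _) mulmxA v0 mul0mx.
have qact (v : 'rV_n.+1) a : a \in s -> v *m (D - a%:M) ^+ (n.+1 + n.+1) = 0 ->
    v *m horner_mx D q = a^* *: v.
  move=> as_ va; apply/eqP; rewrite -subr_eq0 -mul_mx_scalar -mulmxBr.
  rewrite -(horner_mx_C D) -rmorphB /=; apply/eqP.
  apply: hkill (qP a as_).
  by rewrite rmorphXn rmorphB /= horner_mx_X horner_mx_C.
exists (horner_mx D q); split.
  rewrite horD {1}DE.
  have -> : \tr (invmx P *m T *m P *m (invmx P *m horner_mx T q *m P)) =
      \tr (T *m horner_mx T q).
    rewrite !mulmxA mulmxK// [LHS]mxtrace_mulC !mulmxA mulmxV// mul1mx.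
    done.
  have [tq dq] := trig_horner q tP.
  rewrite /mxtrace => tr0.
  have T0 i : T i i = 0.
    have : forall i, i \in 'I_n.+1 -> `|T i i| ^+ 2 = 0.
      apply/psumr_eq0P => [j _|]; first by rewrite exprn_ge0.
      rewrite -[RHS]tr0; apply: eq_bigr => j _.
      rewrite (trig_mulmx tP tq).2 dq normCK; congr (_ * _).
      have /factor_theorem : root (q - (T j j)^*%:P) (T j j).
        rewrite -dvdp_XsubCl; apply: dvdp_trans (qP _ (evs _ (Tev j))).
        by rewrite addSn exprS dvdp_mulIl.
      case=> r /(congr1 (fun p => p.[T j j])); rewrite !hornerE subrr mulr0.
      by move=> /eqP; rewrite subr_eq0 => /eqP.
    by move=> /(_ i isT) /eqP; rewrite sqrf_eq0 normr_eq0 => /eqP.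
  have := Cayley_Hamilton T; rewrite char_poly_trig//.
  under eq_bigr do rewrite T0 subr0.
  rewrite prodr_const cardT size_enum_ord => T00.
  rewrite -(horner_mx_X D) -rmorphXn /= horD T00.
  by rewrite mulmx0 mul0mx.
move=> b bD.
have span (Q : 'rV[K]_n.+1 -> Prop) : (forall u v, Q u -> Q v -> Q (u + v)) -> Q 0 ->
   (forall a v, a \in ev -> v *m (D - a%:M) ^+ n.+1 = 0 -> Q v) -> forall v, Q v.
  move=> QD Q0 Qa v.
  have /sub_sumsmxP[u ->] : (v <= \sum_i kermxpoly D (p_ i))%MS.
    by apply: submx_trans full; rewrite submx1.
  apply: (big_ind Q) => // i _; apply: (Qa (e`_i)).
    by rewrite -mem_undup mem_nth.
  have /sub_kermxP : (u i *m kermxpoly D (p_ i) <= kermxpoly D (p_ i))%MS.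
    exact: submxMl.
  by rewrite /p_ rmorphXn rmorphB /= horner_mx_X horner_mx_C.
have lift (v : 'rV_n.+1) a : v *m (D - a%:M) ^+ n.+1 = 0 ->
    v *m (D - a%:M) ^+ (n.+1 + n.+1) = 0.
  by move=> v0; rewrite exprD -[_ * _]/(_ *m _) mulmxA v0 mul0mx.
set S := horner_mx D q => y z; move: y.
apply: (span (fun y => b y z *m S = b (y *m S) z + b y (z *m S))) => [u v Hu Hv||l y ly y0].
- by rewrite !linearDl /= Hu Hv addrACA.
- by rewrite !linear0l addr0.
move: z; apply: (span (fun z => b y z *m S = b (y *m S) z + b y (z *m S))) => [u v Hu Hv||m z mz z0].
- by rewrite mulmxDl !linearDr /= mulmxDl Hu Hv addrACA.
- by rewrite mul0mx !linear0r mul0mx addr0.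
rewrite /S (qact y l) ?evs ?(lift _ _ y0)// (qact z m) ?evs ?(lift _ _ z0)//.
rewrite (qact (b y z) (l + m)).
- by rewrite linearZl_LR linearZr_LR /= -scalerDl -rmorphD.
- by rewrite mem_undup mem_cat; apply/orP; right; apply/allpairsP; exists (l, m).
- exact: geigen_derivation y0 z0.
Qed.

End ConjPart.

(** * The Killing form and the Casimir element *)

Section AdMatrix.
Variables (K : fieldType) (g : vectType K) (br : {bilinear g -> g -> g}).
Hypothesis brL : is_lie br.

Local Notation e := (vbasis {:g}).
Let eB : basis_of fullv e := vbasisP _.

(** Matrices act on row vectors from the right, so [ad_mx] reverses products. *)
Definition ad_mx (x : g) : 'M[K]_(\dim {:g}) := mxof e e (linfun (br x)).

Lemma rVof_br x y : rVof e (br x y) = rVof e y *m ad_mx x.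
Proof. by rewrite -rVof_app// lfunE. Qed.

Lemma br_vecof x v : br x (vecof e v) = vecof e (v *m ad_mx x).
Proof. by apply: (can_inj (rVofK eB)); rewrite rVof_br !vecofK. Qed.

Lemma mx_act_inj (A B : 'M[K]_(\dim {:g})) :
  (forall y, rVof e y *m A = rVof e y *m B) -> A = B.
Proof.
move=> AB; apply/row_matrixP => i; rewrite !rowE.
by rewrite -(vecofK eB (delta_mx 0 i)).
Qed.

Lemma ad_mx_is_linear : linear ad_mx.
Proof.
move=> c x y; apply: mx_act_inj => z.
by rewrite mulmxDr -scalemxAr -!rVof_br linearPl linearP.
Qed.
HB.instance Definition _ := GRing.isSemilinear.Build K g _ _ ad_mx
  (GRing.semilinear_linear ad_mx_is_linear).

Lemma ad_mx_br x y : ad_mx (br x y) = ad_mx y *m ad_mx x - ad_mx x *m ad_mx y.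
Proof.
apply: mx_act_inj => z.
by rewrite mulmxBr !mulmxA -!rVof_br (lie_jac brL) linearB.
Qed.

Lemma killingE x y : killing br x y = \tr (ad_mx y *m ad_mx x).
Proof.
rewrite /killing /ad_mx -mxof_comp//; congr (\tr (mxof e e _)).
by apply/lfunP => z; rewrite !lfunE /= lfunE /= lfunE.
Qed.

Lemma killingPl c x y z : killing br (c *: x + y) z = c * killing br x z + killing br y z.
Proof. by rewrite !killingE linearP mulmxDr -scalemxAr linearP. Qed.

Lemma killingC x y : killing br x y = killing br y x.
Proof. by rewrite !killingE mxtrace_mulC. Qed.

Lemma killingPr c x y z : killing br x (c *: y + z) = c * killing br x y + killing br x z.
Proof. by rewrite !(killingC x) killingPl. Qed.

Lemma killing_assoc x y z : killing br (br x y) z = killing br x (br y z).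
Proof.
rewrite !killingE !ad_mx_br mulmxBr mulmxBl !linearB /= !mulmxA.
by rewrite [X in _ - X]mxtrace_mulC mulmxA.
Qed.

Lemma killing0l y : killing br 0 y = 0.
Proof. by rewrite killingE linear0 mulmx0 linear0. Qed.

Lemma killingNl x y : killing br (- x) y = - killing br x y.
Proof. by rewrite -scaleN1r -[_ *: _]addr0 killingPl killing0l addr0 mulN1r. Qed.

Lemma killingNr x y : killing br x (- y) = - killing br x y.
Proof. by rewrite !(killingC x) killingNl. Qed.

Lemma killing_bilinear : bilinear_for *:%R *:%R (killing br : g -> g -> K^o).
Proof. by split=> z c x y; [apply: killingPl|apply: killingPr]. Qed.

(** The Killing form with codomain [K^o], to make it a bilinear map. *)
Definition killing_form : g -> g -> K^o := killing br.
HB.instance Definition _ :=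
  bilinear_isBilinear.Build K g g K^o *:%R *:%R killing_form killing_bilinear.

(** The bracket in coordinates, to which [conj_semisimple_part] applies. *)
Definition rowbr (u v : 'rV[K]_(\dim {:g})) := rVof e (br (vecof e u) (vecof e v)).

Lemma rowbr_bilinear : bilinear_for *:%R *:%R rowbr.
Proof.
by split=> w c u v; rewrite /rowbr linearP ?linearPl ?linearPr linearP.
Qed.
HB.instance Definition _ := bilinear_isBilinear.Build K _ _ _ *:%R *:%R rowbr rowbr_bilinear.

Lemma rVof_iter k x y : rVof e (iter k (br x) y) = rVof e y *m ad_mx x ^+ k.
Proof.
elim: k => [|k IH]; first by rewrite expr0 mulmx1.
by rewrite iterS rVof_br IH exprSr mulmxA.
Qed.

End AdMatrix.

Section Killing.
Variables (K : numClosedFieldType) (g : vectType K) (br : {bilinear g -> g -> g}).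
Hypothesis hg : simple_lie br.

Local Notation e := (vbasis {:g}).
Let eB : basis_of fullv e := vbasisP _.
Let brL : is_lie br. Proof. by case: hg. Qed.
Local Notation kap := (killing br).
Local Notation ad_mx := (ad_mx br).

(** Cartan's criterion. Suppose [kap = 0] and let [S] be the conjugate part of
    [ad x], the matrix of a derivation [del] of [g]. Then
    [tr (ad [y, z] S) = kap (del y) z = 0] by cyclicity of the trace, hence
    [tr (ad x S) = 0] since [g] is perfect, and [ad x] is nilpotent for every [x],
    against Engel's theorem. *)
Lemma killing_neq0 : exists x y, kap x y != 0.
Proof.
apply: contrapT => k0; have {}k0 x y : kap x y = 0.
  by apply/eqP; apply: contrapT => /negP nk; apply: k0; exists x, y.
apply: (simple_not_nil hg) => x y; exists (\dim {:g}).
apply: (can_inj (rVofK eB)); rewrite rVof_iter linear0.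
have [S [trS derS]] := conj_semisimple_part (ad_mx x).
suff tr0 : \tr (ad_mx x *m S) = 0 by rewrite trS// mulmx0.
have {}derS u v : rowbr br u v *m S = rowbr br (u *m S) v + rowbr br u (v *m S).
  apply: (derS (rowbr br : {bilinear 'rV[K]_(\dim {:g}) -> 'rV[K]_(\dim {:g}) -> 'rV[K]_(\dim {:g})})).
  move=> u1 v1; rewrite /= /rowbr -!rVof_br -!br_vecof -linearD /=.
  by rewrite (lie_jac brL x) subrK.
pose del y := vecof e (rVof e y *m S).
have delE z : ad_mx z *m S = ad_mx (del z) + S *m ad_mx z.
  apply: mx_act_inj => t; rewrite mulmxDr !mulmxA -!rVof_br.
  have := derS (rVof e z) (rVof e t); rewrite /rowbr !rVofK// => ->.
  by rewrite /= (rVof_br _ z) vecofK.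
move: x {derS trS y}; apply: (simple_perfect hg) => [c x y x0 y0|y z].
  by rewrite linearP /= mulmxDl -scalemxAl linearP /= x0 y0 mulr0 addr0.
rewrite (ad_mx_br brL) mulmxBl linearB /= -!mulmxA (delE y) mulmxDr linearD /= -killingE k0 add0r.
by rewrite [X in _ - X]mxtrace_mulC !mulmxA subrr.
Qed.

(** The radical of the Killing form is an ideal, and not all of [g]. *)
Lemma killing_nondeg x : (forall y, kap x y = 0) -> x = 0.
Proof.
move=> x0; apply/eqP; apply: contrapT => /negP xn0.
have [y [z /eqP]] := killing_neq0; apply; move: y z.
apply: (simple_ideal hg) => [z|c u v hu hv z|u v hv z|].
- exact: killing0l.
- by rewrite killingPl hu hv mulr0 addr0.
- by rewrite (lie_anti brL) killingNl killing_assoc// hv oppr0.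
- by exists x.
Qed.

Definition gram : 'M[K]_(\dim {:g}) := \matrix_(i, j) kap e`_i e`_j.

Lemma vecofE v : vecof e v = \sum_i v 0 i *: e`_i. Proof. by []. Qed.

Lemma killing_vecof v y : kap (vecof e v) y = \sum_i v 0 i * kap e`_i y.
Proof.
rewrite vecofE; have -> : kap = killing_form br by [].
rewrite linear_sumlz /=; apply: eq_bigr => i _; exact: linearZl_LR.
Qed.

Lemma vecof_gram v : v *m gram = \row_j kap (vecof e v) e`_j.
Proof.
by apply/rowP => j; rewrite !mxE killing_vecof; apply: eq_bigr => i _; rewrite mxE.
Qed.

Lemma basis_ext (V : lmodType K) (f h : g -> V) : linear f -> linear h ->
  (forall j : 'I_(\dim {:g}), f e`_j = h e`_j) -> f =1 h.
Proof.
move=> lf lh fh y; rewrite -(rVofK eB y) vecofE.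
pose F := GRing.isSemilinear.Build K g V _ f (GRing.semilinear_linear lf).
pose G := GRing.isSemilinear.Build K g V _ h (GRing.semilinear_linear lh).
pose f' : {linear g -> V} := HB.pack f F; pose h' : {linear g -> V} := HB.pack h G.
rewrite -[f]/(f' : _ -> _) -[h]/(h' : _ -> _) !linear_sum.
by apply: eq_bigr => j _; rewrite !linearZ /= fh.
Qed.

Lemma killing_lin (x : g) : linear (kap x : g -> K^o).
Proof. by move=> c y z; apply: killingPr. Qed.

Lemma gram_unit : gram \in unitmx.
Proof.
rewrite -row_free_unit -kermx_eq0; apply/rowV0P => v /sub_kermxP vG.
suff : vecof e v = 0 by move=> /(congr1 (rVof e)); rewrite vecofK// linear0.
apply: killing_nondeg => y.
apply: (@basis_ext K^o (kap (vecof e v)) (fun=> 0)) => [||j].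
- exact: killing_lin.
- by move=> c u w; rewrite scaler0 addr0.
by have /rowP/(_ j) := vecof_gram v; rewrite vG !mxE => <-.
Qed.

Definition dual_basis (i : 'I_(\dim {:g})) : g := \sum_j (invmx gram) i j *: e`_j.
Local Notation f := dual_basis.

Lemma killing_dual i (k : 'I_(\dim {:g})) : kap (f i) e`_k = (i == k)%:R.
Proof.
have -> : f i = vecof e (row i (invmx gram)).
  by rewrite vecofE; apply: eq_bigr => j _; rewrite mxE.
rewrite killing_vecof; have := mulVmx gram_unit => /matrixP /(_ i k).
rewrite !mxE => <-; apply: eq_bigr => j _; by rewrite !mxE.
Qed.

Lemma coord_killing i x : coord e i x = kap (f i) x.
Proof.
apply: (@basis_ext K^o (coord e i) (kap (f i))) => [c y z||j].
- by rewrite linearP.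
- exact: killing_lin.
by rewrite killing_dual coord_free ?(basis_free eB)// eq_sym.
Qed.

Lemma dual_expand1 x : x = \sum_i kap (f i) x *: e`_i.
Proof. by rewrite {1}(coord_basis eB (memvf x)); apply: eq_bigr => i _; rewrite coord_killing. Qed.

Lemma killing_suml I (r : seq I) (c : I -> K) (z : I -> g) y :
  kap (\sum_(i <- r) c i *: z i) y = \sum_(i <- r) c i * kap (z i) y.
Proof.
have -> : kap = killing_form br by [].
rewrite linear_sumlz /=; apply: eq_bigr => i _; exact: linearZl_LR.
Qed.

Lemma killing_inj x y : (forall z, kap x z = kap y z) -> x = y.
Proof.
move=> xy; apply/eqP; rewrite -subr_eq0; apply/eqP/killing_nondeg => z.
by rewrite addrC -scaleN1r killingPl xy mulN1r addrC subrr.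
Qed.

Lemma dual_expand2 x : x = \sum_(i < \dim {:g}) kap x e`_i *: f i.
Proof.
apply: killing_inj.
apply: (@basis_ext K^o (kap x) (kap (\sum_(i < \dim {:g}) kap x e`_i *: f i))) => [||j].
- exact: killing_lin.
- exact: killing_lin.
 rewrite killing_suml (bigD1 j)//= killing_dual eqxx mulr1.
by rewrite big1 ?addr0// => i ij; rewrite killing_dual (negPf ij) mulr0.
Qed.

Lemma trace_killing (A : 'End(g)) : \tr (mxof e e A) = \sum_i kap (f i) (A e`_i).
Proof.
apply: eq_bigr => i _; rewrite -coord_killing coord_rVof (rVof_app (e := e) e eB).
by rewrite rVofE ?(basis_free eB)// -rowE [RHS]mxE.
Qed.

(** The Casimir element acts on the adjoint representation as the identity: paired
    with [y], the left side is [tr (ad x ad y)] expanded in dual bases. *)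
Lemma casimir_id x : \sum_(i < \dim {:g}) br e`_i (br (f i) x) = x.
Proof.
apply: killing_inj => y; rewrite {2}/killing trace_killing.
under eq_bigr do rewrite -[br _ _]scale1r.
rewrite killing_suml; apply: eq_bigr => i _.
rewrite mul1r lfunE /= (lie_anti brL e`_i) killingNl killing_assoc// (lie_anti brL e`_i).
by rewrite killingNr opprK killing_assoc.
Qed.

(** The Casimir tensor is killed by [g]: the matrix of [ad y] in the dual basis is
    minus the transpose of its matrix in the basis. *)
Lemma casimir_invariant (V : lmodType K) (b : {bilinear g -> g -> V}) y :
  \sum_(i < \dim {:g}) (b (br y e`_i) (f i) + b e`_i (br y (f i))) = 0.
Proof.
rewrite big_split /=.
under eq_bigr => i _ do rewrite (dual_expand1 (br y e`_i)) linear_sumlz /=.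
under [X in _ + X]eq_bigr => i _ do rewrite (dual_expand2 (br y (f i))) linear_sumr /=.
rewrite [X in _ + X]exchange_big -big_split big1 //= => i _.
rewrite -big_split big1 //= => j _.
rewrite linearZl_LR linearZr_LR /= -scalerDl (lie_anti brL y (f j)) killingNl.
by rewrite killing_assoc// subrr scale0r.
Qed.

(** Schur's lemma: if [a] is an eigenvalue of [c] relative to the Killing form, the
    radical of [c - a kap] is a nonzero ideal. *)
Lemma invariant_form_scalar (c : {bilinear g -> g -> K^o}) :
  (forall z x y, c (br z x) y + c x (br z y) = 0) ->
  exists a, forall x y, c x y = a * kap x y.
Proof.
move=> cinv; pose C : 'M[K]_(\dim {:g}) := \matrix_(i, j) c e`_i e`_j.
have n_gt0 : (0 < \dim {:g})%N.
  rewrite lt0n dimv_eq0; apply/eqP => g0; have [_ [x [y /eqP xy]] _] := hg.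
  by apply: xy; apply/eqP; rewrite -memv0 -g0 memvf.
have [a /eigenvalueP[v vC v0]] := eigenvalue_closed (C *m invmx gram) n_gt0.
exists a.
have vCG : v *m C = a *: (v *m gram).
  by rewrite scalemxAl -vC -!mulmxA mulVmx ?gram_unit// mulmx1.
apply: (simple_ideal hg) => [y|b x z hx hz y|x z hz y|].
- by rewrite killing0l ?linear0l ?mulr0.
- by rewrite linearPl killingPl// hx hz /= [_ *: _]mulrCA mulrDr.
- apply/eqP; rewrite -subr_eq0; have /eqP := cinv x z y; rewrite addr_eq0 => /eqP ->.
  rewrite hz (lie_anti brL x z) killingNl killing_assoc//.
  by rewrite mulrN opprK addNr.
exists (vecof e v); last by rewrite vecof_eq0.
apply: (@basis_ext K^o (c (vecof e v)) (fun y => a * kap (vecof e v) y)) => [||j].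
- exact: linearP.
- by move=> b y z; rewrite killingPr mulrDr mulrCA.
have /rowP/(_ j) := vCG; rewrite vecof_gram !mxE => <-.
rewrite vecofE linear_sumlz; apply: eq_bigr => i _.
by rewrite mxE linearZl_LR.
Qed.

(** The form [c] induces a linear map [C] on [g (x) g], realised as matrices. A
    scalar form on matrices vanishing on the kernel of [C] is invariant, thus
    proportional to [kap]; therefore [E x y - kap x y *: E x0 y0] is killed by all of
    them and lies in the kernel of [C]. *)
Lemma invariant_form (V : lmodType K) (c : {bilinear g -> g -> V}) :
  (forall z x y, c (br z x) y + c x (br z y) = 0) ->
  exists v, forall x y, c x y = kap x y *: v.
Proof.
move=> cinv.
have [x0 [y0 k0]] : exists x y, kap x y = 1.
  have [x [y xy]] := killing_neq0; exists ((kap x y)^-1 *: x), y.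
  by rewrite -[_ *: _]addr0 killingPl killing0l// addr0 mulVf.
exists (c x0 y0) => x y.
(* the map induced by [c] on [g (x) g], and the pure tensors *)
pose C (m : 'M[K]_(\dim {:g})) :=
  \sum_(i < \dim {:g}) \sum_(j < \dim {:g}) m i j *: c e`_i e`_j.
have Clin : linear C.
  move=> a m m'; rewrite /C scaler_sumr -big_split; apply: eq_bigr => i _ /=.
  rewrite scaler_sumr -big_split; apply: eq_bigr => j _ /=.
  by rewrite !mxE scalerDl scalerA.
have C0 : C 0 = 0 by rewrite /C big1 // => i _; rewrite big1 // => j _; rewrite mxE scale0r.
pose E (x y : g) := (rVof e x)^T *m rVof e y.
have E_l a u v w : E (a *: u + v) w = a *: E u w + E v w.
  by rewrite /E !linearP /= mulmxDl -scalemxAl.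
have E_r a u v w : E w (a *: u + v) = a *: E w u + E w v.
  by rewrite /E !linearP.
have CE u v : C (E u v) = c u v.
  rewrite /C {2}(coord_basis eB (memvf u)) linear_sumlz; apply: eq_bigr => i _.
  rewrite linearZl_LR {2}(coord_basis eB (memvf v)) linear_sumr /= scaler_sumr.
  apply: eq_bigr => j _; rewrite linearZr_LR /= scalerA; congr (_ *: _).
  by rewrite mxE big_ord1 !mxE.
have [W WP] : exists W : {vspace 'M[K]_(\dim {:g})}, forall m, m \in W <-> C m = 0.
  apply: vspace_of_pred => // a m m' h h'.
  by rewrite Clin h h' scaler0 addr0.
suff : E x y - kap x y *: E x0 y0 \in W.
  move=> /WP; rewrite addrC -scaleNr Clin !CE => /eqP.
  by rewrite addr_eq0 scaleNr eqr_opp => /eqP ->.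
suff /eqP : E x y - kap x y *: E x0 y0 - projv W (E x y - kap x y *: E x0 y0) = 0.
  by rewrite subr_eq0 => /eqP ->; apply: memv_proj.
apply/matrixP => i j; rewrite [RHS]mxE.
pose phi m : K^o := (m - projv W m) i j.
have phi_lin : linear phi.
  move=> a m m'; rewrite /phi linearP opprD addrACA -scalerBr.
  by rewrite !mxE.
have phiB : bilinear_for *:%R *:%R (fun u v => phi (E u v)).
  by split=> w a u v; rewrite ?E_l ?E_r phi_lin.
pose F := bilinear_isBilinear.Build K g g K^o *:%R *:%R _ phiB.
pose phi' : {bilinear g -> g -> K^o} := HB.pack (fun u v => phi (E u v)) F.
have [z u v|a aP] := invariant_form_scalar (c := phi').
  rewrite /= -[X in X + _]scale1r -phi_lin scale1r.
  have : E (br z u) v + E u (br z v) \in W.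
    apply/WP; rewrite -[X in X + _]scale1r Clin scale1r !CE; exact: cinv.
  by move=> /projv_id; rewrite /phi => ->; rewrite subrr mxE.
have {}aP u v : phi (E u v) = a * kap u v by apply: aP.
rewrite -/(phi _) addrC -scaleNr phi_lin !aP k0 mulr1 /GRing.scale /= mulNr mulrC addNr.
done.
Qed.

End Killing.

(** * Universal properties: tensor products, differentials, differentials modulo exact ones *)

Section Submodule.
Variables (R : nzRingType) (V : lmodType R) (P : V -> Prop).
Hypothesis (P0 : P 0) (PL : forall a x y, P x -> P y -> P (a *: x + y)).

(** The closure proofs are arguments, so that the closed-predicate structure can be
    attached to the constant. *)
Definition submod_pred of P 0 & (forall a x y, P x -> P y -> P (a *: x + y)) : {pred V} :=
  fun x => `[< P x >].

Fact submod_predP : GRing.submod_closed (submod_pred P0 PL).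
Proof.
split; first exact/asboolP.
by move=> a x y /asboolP Px /asboolP Py; apply/asboolP/PL.
Qed.
HB.instance Definition _ := GRing.isSubmodClosed.Build R V (submod_pred P0 PL) submod_predP.

Record submod_of := SubmodOf { submod_val : V; _ : submod_val \in submod_pred P0 PL }.
HB.instance Definition _ := [isSub for submod_val].
HB.instance Definition _ := [Choice of submod_of by <:].
HB.instance Definition _ := [SubChoice_isSubLmodule of submod_of by <:].

End Submodule.

Section TensorInd.
Variables (K : fieldType) (V W T : lmodType K) (tens : {bilinear V -> W -> T}).
Hypothesis hT : is_tensor_product tens.

(** A linearly closed predicate true on pure tensors defines a subspace [M]
    through which the universal bilinear map factors; composed with the inclusion,
    the induced map [T -> M] is an endomorphism fixing the pure tensors, hence the
    identity. The same argument gives generation by [d] for differentials, and by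
    [t], [t^-1], [u] for the hyperelliptic ring. *)
Lemma tensor_ind (P : T -> Prop) :
  (forall a x y, P x -> P y -> P (a *: x + y)) ->
  (forall v w, P (tens v w)) -> forall x, P x.
Proof.
move=> PL Pt; have P0 : P 0 by rewrite -(linear0l tens 0).
pose M : lmodType K := submod_of P0 PL.
have tm v w : tens v w \in submod_pred P0 PL by apply/asboolP.
pose b v w : M := SubmodOf (tm v w).
have bb : bilinear_for *:%R *:%R b.
  by split=> z a u v; apply: val_inj; rewrite linearP /= ?linearPl ?linearPr.
pose F := bilinear_isBilinear.Build K V W M *:%R *:%R b bb.
pose b' : {bilinear V -> W -> M} := HB.pack b F.
have [f [fE _]] := hT b'.
have [h [_ hU]] := hT tens.
pose f' : {linear T -> T} := (val : {linear M -> T}) \o f.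
have f'E v w : f' (tens v w) = tens v w by rewrite /= fE.
move=> x; have -> : x = f' x by rewrite hU// -(hU idfun).
by have /asboolP := valP (f x).
Qed.

End TensorInd.

Section KaehlerInd.
Variables (K : fieldType) (A : comAlgType K) (Om : lmodType A) (d : A -> Om).
Hypothesis hd : is_kaehler d.

Lemma kaehler_ind (P : Om -> Prop) :
  (forall a x y, P x -> P y -> P (a *: x + y)) ->
  (forall a, P (d a)) -> forall x, P x.
Proof.
have [[dD dM dC] univ] := hd.
move=> PL Pd; have P0 : P 0 by rewrite -(dC 0).
have dm a : d a \in submod_pred P0 PL by apply/asboolP.
have [|f [fE _]] := univ (submod_of P0 PL) (fun a => SubmodOf (dm a)).
  by split=> [a b|a b|c]; apply: val_inj; rewrite /= ?dD ?dM ?dC ?linearD ?linearZ ?linear0.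
have [//|h [_ hU]] := univ Om d.
pose f' : {linear Om -> Om} := (val : {linear (submod_of P0 PL) -> Om}) \o f.
have f'E a : f' (d a) = d a by rewrite /= fE.
move=> x; have -> : x = f' x by rewrite hU// -(hU idfun).
by have /asboolP := valP (f x).
Qed.

End KaehlerInd.

Section MakeLinear.
Variables (R : nzRingType) (U V W : lmodType R).

Lemma linear_map (f : U -> V) : linear f -> exists f' : {linear U -> V}, f' =1 f.
Proof.
move=> lf.
pose F := GRing.isSemilinear.Build R U V _ f (GRing.semilinear_linear lf).
by exists (HB.pack f F : {linear U -> V}).
Qed.

Lemma bilinear_map (b : U -> V -> W) : bilinear_for *:%R *:%R b ->
  exists b' : {bilinear U -> V -> W}, forall x y, b' x y = b x y.
Proof.
move=> bb; pose F := bilinear_isBilinear.Build R U V W *:%R *:%R b bb.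
by exists (HB.pack b F : {bilinear U -> V -> W}).
Qed.

End MakeLinear.

Section TensorMaps.
Variables (K : fieldType) (V W T : lmodType K) (tens : {bilinear V -> W -> T}).
Hypothesis hT : is_tensor_product tens.

Lemma tensor_lift (M : lmodType K) (b : V -> W -> M) : bilinear_for *:%R *:%R b ->
  exists f : {linear T -> M}, forall v w, f (tens v w) = b v w.
Proof.
move=> /bilinear_map[b' b'E]; have [f [fE _]] := hT b'.
by exists f => v w; rewrite fE b'E.
Qed.

Lemma tensor_ext (M : lmodType K) (f h : {linear T -> M}) :
  (forall v w, f (tens v w) = h (tens v w)) -> f =1 h.
Proof.
move=> fh; apply: (tensor_ind hT) => // a x y hx hy.
by rewrite !linearP hx hy.
Qed.

(** A map on [T * T] given on pure tensors. The universal property is applied once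
    for each right argument, then once with values in the functions [T -> M]. *)
Lemma tensor_lift2 (M : lmodType K) (b : V -> W -> V -> W -> M) :
  (forall y z, bilinear_for *:%R *:%R (fun x w => b x w y z)) ->
  (forall y z, bilinear_for *:%R *:%R (b y z)) ->
  exists B : {bilinear T -> T -> M},
    forall x a y c, B (tens x a) (tens y c) = b x a y c.
Proof.
move=> bl br.
have /choice[L LE] (p : V * W) : exists L : {linear T -> M},
    forall x a, L (tens x a) = b x a p.1 p.2.
  exact: tensor_lift (bl p.1 p.2).
have LL : bilinear_for *:%R *:%R (fun y c => (L (y, c) : T -> M)).
  split=> z k u v; apply/funext.
    apply: (@tensor_ext _ (L (k *: u + v, z)) (k \*: L (u, z) \+ L (v, z))) => x a.
    by rewrite /= !LE /= (br _ _).1.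
  apply: (@tensor_ext _ (L (z, k *: u + v)) (k \*: L (z, u) \+ L (z, v))) => x a.
  by rewrite /= !LE /= (br _ _).2.
have [F FE] := tensor_lift LL.
have Flin s : linear (F s).
  move: s; apply: (tensor_ind hT) => [k s s' ls ls' k' x y|y c].
    rewrite linearP -[LHS]/(k *: F s _ + F s' _) ls ls'.
    rewrite -[RHS]/(k' *: (k *: F s _ + F s' _) + (k *: F s _ + F s' _)).
    by rewrite !scalerDr !scalerA mulrC addrACA.
  by rewrite FE; apply: linearP.
have [|B BE] := @bilinear_map K T T M (fun s s' => F s' s).
  split=> [s|s] k x y; first exact: Flin.
  by rewrite linearP.
by exists B => x a y c; rewrite BE FE LE.
Qed.

End TensorMaps.

Section ModExact.
Variables (K : fieldType) (A : comAlgType K) (Om : lmodType A) (d : A -> Om).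
Hypothesis hd : is_kaehler d.
Variables (H : lmodType K) (cls : Om -> H).
Hypothesis hcls : is_mod_exact d cls.

Lemma clsP (c : K) w w' : cls (c%:A *: w + w') = c *: cls w + cls w'.
Proof. by case: hcls. Qed.

Lemma clsD w w' : cls (w + w') = cls w + cls w'.
Proof. by rewrite -[w in LHS]scale1r -(scale1r (1 : A)) clsP scale1r. Qed.

Lemma cls_exact a : cls (d a) = 0.
Proof. by case: hcls => _ _ k; apply/k; exists a. Qed.

Lemma cls0 : cls 0 = 0.
Proof. by apply: (addrI (cls 0)); rewrite -clsD !addr0. Qed.

Lemma clsZ c w : cls (c%:A *: w) = c *: cls w.
Proof. by rewrite -[_ *: w]addr0 clsP cls0 addr0. Qed.

Lemma cls_sum I (r : seq I) (P : pred I) F :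
  cls (\sum_(i <- r | P i) F i) = \sum_(i <- r | P i) cls (F i).
Proof. exact: (big_morph cls clsD cls0). Qed.

Lemma derD a b : d (a + b) = d a + d b. Proof. by case: hd => -[]. Qed.
Lemma derM a b : d (a * b) = a *: d b + b *: d a. Proof. by case: hd => -[]. Qed.
Lemma derC (c : K) : d c%:A = 0. Proof. by case: hd => -[]. Qed.

Lemma derZ (c : K) a : d (c *: a) = c%:A *: d a.
Proof. by rewrite -[a in LHS]mul1r scalerAl derM derC scaler0 addr0. Qed.

Lemma cls_bilinear : bilinear_for *:%R *:%R (fun a b => cls (a *: d b)).
Proof.
split=> b c u v.
  by rewrite scalerDl -mulr_algl -scalerA clsP.
by rewrite derD derZ scalerDr scalerA [b * _]mulrC -scalerA clsP.
Qed.

Lemma cls_anti a b : cls (a *: d b) = - cls (b *: d a).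
Proof. by apply/eqP; rewrite -addr_eq0 -clsD -derM cls_exact. Qed.

Lemma cls_leibniz a b c : cls (a *: d (b * c)) = cls ((a * b) *: d c) + cls ((a * c) *: d b).
Proof. by rewrite derM scalerDr !scalerA clsD. Qed.

(** [Omega] is generated over [A] by the [d b], so [Omega / dA] is spanned over [K] by
    the classes of the [a *: d b]. The induction carries a multiplier [a] because
    [cls] is only [K]-linear. *)
Lemma mod_exact_ind (P : H -> Prop) :
  (forall k x y, P x -> P y -> P (k *: x + y)) ->
  (forall a b, P (cls (a *: d b))) -> forall h, P h.
Proof.
move=> PL Pab h; have [_ /(_ h)[w <-] _] := hcls.
rewrite -(scale1r w); move: (1 : A) => a; move: w a.
apply: (kaehler_ind hd) => [b x y hx hy a|b a]; last exact: Pab.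
rewrite scalerDr scalerA clsD -[cls _]scale1r; exact: PL.
Qed.

End ModExact.

Section Cocycle.
Variables (K : fieldType) (A : comAlgType K) (V : lmodType K).

Definition lin_pred : {pred A -> V} := fun f => `[< linear f >].
Fact lin_predP : GRing.zmod_closed lin_pred.
Proof.
split; first by apply/asboolP => c x y; rewrite /= scaler0 addr0.
move=> f h /asboolP lf /asboolP lh; apply/asboolP => c x y.
rewrite -[LHS]/(f _ - h _) lf lh opprD addrACA -scalerBr; done.
Qed.
HB.instance Definition _ := GRing.isZmodClosed.Build (A -> V) lin_pred lin_predP.

(** [Hom_K(A, V)], on which [A] acts through its multiplication. *)
Record dual_mod := DualMod { dual_val : A -> V; _ : dual_val \in lin_pred }.
HB.instance Definition _ := [isSub for dual_val].
HB.instance Definition _ := [Choice of dual_mod by <:].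
HB.instance Definition _ := [SubChoice_isSubZmodule of dual_mod by <:].

Lemma dual_linear (f : dual_mod) : linear (val f).
Proof. by have /asboolP := valP f. Qed.

Fact dual_scale_subproof a (f : dual_mod) : (fun x => val f (x * a)) \in lin_pred.
Proof. by apply/asboolP => c x y; rewrite mulrDl -scalerAl dual_linear. Qed.

Definition dual_scale a f := DualMod (dual_scale_subproof a f).

Fact dual_scaleA a b f : dual_scale a (dual_scale b f) = dual_scale (a * b) f.
Proof. by apply/val_inj/funext => x /=; rewrite mulrA. Qed.
Fact dual_scale1 : left_id 1 dual_scale.
Proof. by move=> f; apply/val_inj/funext => x /=; rewrite mulr1. Qed.
Fact dual_scaleDr : right_distributive dual_scale +%R.
Proof. by move=> a f h; apply/val_inj/funext => x. Qed.
Fact dual_scaleDl f : {morph dual_scale^~ f : a b / a + b}.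
Proof.
move=> a b; apply/val_inj/funext => x /=; rewrite mulrDr.
by rewrite -[x * a]scale1r dual_linear scale1r.
Qed.
HB.instance Definition _ := GRing.Zmodule_isLmodule.Build A dual_mod
  dual_scaleA dual_scale1 dual_scaleDr dual_scaleDl.

Variables (Om : lmodType A) (d : A -> Om) (hd : is_kaehler d).
Variables (H : lmodType K) (cls : Om -> H) (hcls : is_mod_exact d cls).

(** The linear maps out of [Omega / dA] are the cyclic cocycles. Given [psi], the
    map [b |-> psi ^~ b] is a derivation of [A] in [Hom_K(A, V)]; it factors through
    [Omega], and evaluation at [1] gives a [K]-linear map sending [a *: d b] to
    [psi a b], which kills exact differentials because [psi a 1 = 0]. *)
Lemma cocycle_lift (psi : A -> A -> V) :
  bilinear_for *:%R *:%R psi -> (forall a b, psi a b = - psi b a) ->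
  (forall a b c, psi a (b * c) = psi (a * b) c + psi (a * c) b) ->
  exists f : {linear H -> V}, forall a b, f (cls (a *: d b)) = psi a b.
Proof.
move=> /bilinear_map[psi' psiE] anti leib.
have psi1r a : psi a 1 = 0.
  by apply: (addrI (psi a 1)); have := leib a 1 1; rewrite !mulr1 addr0 => <-.
have Dp b : (fun a => psi a b) \in lin_pred.
  by apply/asboolP => k x y; rewrite -!psiE linearPl.
have [|F [FE _]] := hd.2 dual_mod (fun b => DualMod (Dp b)).
  split=> [b c|b c|k]; apply/val_inj/funext => a /=.
  - by rewrite -psiE linearDr !psiE.
  - exact: leib.
  - by rewrite -psiE linearZr_LR /= psiE psi1r scaler0.
(* [lam (a *: d b) = psi (1 * a) b] *)
pose lam w := val (F w) 1.
have lamP (c : K) w w' : lam (c%:A *: w + w') = c *: lam w + lam w'.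
  rewrite /lam linearP /= -[LHS]/(val (F w) (1 * c%:A) + val (F w') 1).
  have := dual_linear (F w) c 1 0; rewrite !addr0 mul1r => ->.
  by have := dual_linear (F w) (-1) 0 0; rewrite scaler0 addr0 scaleN1r addNr => ->; rewrite addr0.
have lam_d a : lam (d a) = 0 by rewrite /lam FE /= anti psi1r oppr0.
have [_ surj ker] := hcls.
have lam_cls w w' : cls w = cls w' -> lam w = lam w'.
  move=> ww'; have /ker[a /eqP] : cls ((-1)%:A *: w' + w) = 0.
    by rewrite (clsP hcls) ww' scaleN1r addNr.
  rewrite scaleN1r scaleNr scale1r addrC subr_eq => /eqP ->.
  by rewrite -[d a]scale1r -(scale1r (1 : A)) lamP scale1r lam_d add0r.
have /choice[sig sigK] := surj.
have [|f fE] := @linear_map K H V (lam \o sig).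
  move=> k x y /=; rewrite -lamP; apply: lam_cls.
  by rewrite (clsP hcls) !sigK.
exists f => a b; rewrite fE /= (lam_cls _ (a *: d b)) ?sigK//.
by rewrite /lam linearZ /= FE /= mul1r.
Qed.

End Cocycle.

(** * The universal central extension of a current algebra *)

Lemma eq_opp_eq0 (K : numFieldType) (V : lmodType K) (x : V) : x = - x -> x = 0.
Proof.
move=> /eqP; rewrite -addr_eq0 -mulr2n -scaler_nat scaler_eq0 pnatr_eq0 /=.
by move/eqP.
Qed.

Section CentralLift.
Variables (K : fieldType) (T : lmodType K) (brT : {bilinear T -> T -> T}).
Variables (F : lmodType K) (brF : {bilinear F -> F -> F}) (rho : {linear F -> T}).
Hypothesis cF : central_extension brT brF rho.

(** In a central extension the bracket of two elements depends only on their
    images, so the bracket of lifts is a well defined bilinear map [B] on the base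
    with values in the extension. *)
Lemma central_lift : exists B : {bilinear T -> T -> F},
  [/\ forall e e', brF e e' = B (rho e) (rho e'),
      forall X Y, rho (B X Y) = brT X Y,
      forall X Y, B X Y = - B Y X &
      forall X Y Z, B X (brT Y Z) = B (brT X Y) Z + B Y (brT X Z)].
Proof.
have [brL hrho /choice[s sK] cen] := cF.
(* any set-theoretic section [s] will do: the error terms are central *)
have BE e e' : brF e e' = brF (s (rho e)) (s (rho e')).
  have l u v w : rho u = rho v -> brF u w = brF v w.
    by move=> uv; apply/eqP; rewrite -subr_eq0 -linearBl cen// linearB uv subrr.
  rewrite (l e (s (rho e))) ?sK// (lie_anti brL) (l e' (s (rho e'))) ?sK//.
  by rewrite -(lie_anti brL).
have [B BP] : exists B : {bilinear T -> T -> F}, forall X Y, B X Y = brF (s X) (s Y).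
  apply: bilinear_map; split=> Z k X Y.
    by rewrite -linearPl [RHS]BE linearP !sK.
  by rewrite -linearPr [RHS]BE linearP !sK.
have BF e e' : brF e e' = B (rho e) (rho e') by rewrite BP.
exists B; split=> // [X Y|X Y|X Y Z].
- by rewrite BP hrho !sK.
- by rewrite !BP (lie_anti brL).
have -> : B X (brT Y Z) = brF (s X) (brF (s Y) (s Z)) by rewrite BF hrho !sK.
have -> : B (brT X Y) Z = brF (brF (s X) (s Y)) (s Z) by rewrite BF hrho !sK.
have -> : B Y (brT X Z) = brF (s Y) (brF (s X) (s Z)) by rewrite BF hrho !sK.
by rewrite (lie_jac brL) subrK.
Qed.

End CentralLift.

Section Kassel.
Variables (K : numClosedFieldType) (g : vectType K) (br : {bilinear g -> g -> g}).
Hypothesis hg : simple_lie br.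
Variables (A : comAlgType K) (T : lmodType K) (tens : {bilinear g -> A -> T}).
Variables (brT : {bilinear T -> T -> T}) (hT : is_current_lie br tens brT).
Variables (Om : lmodType A) (d : A -> Om) (hd : is_kaehler d).
Variables (H : lmodType K) (cls : Om -> H) (hcls : is_mod_exact d cls).

Local Notation kap := (killing br).
Local Notation e i := ((vbasis {:g})`_i).
Local Notation f := (dual_basis br).

Let brL : is_lie br. Proof. by case: hg. Qed.
Let hTens : is_tensor_product tens. Proof. by case: hT. Qed.
Let brTL : is_lie brT. Proof. by case: hT. Qed.
Let brTE x y a b : brT (tens x a) (tens y b) = tens (br x y) (a * b).
Proof. by case: hT. Qed.

Lemma killing_eq1 : exists x y, kap x y = 1.
Proof.
have [x [y xy]] := killing_neq0 hg; exists ((kap x y)^-1 *: x), y.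
by rewrite -[_ *: _]addr0 killingPl// killing0l// addr0 mulVf.
Qed.

Lemma killing_br_neq0 : exists x y z, kap (br x y) z != 0.
Proof.
apply: contrapT => k0; have [x [z]] := killing_neq0 hg; move/eqP; apply.
move: x; apply: (simple_perfect hg) => [c x y hx hy|x y].
  by rewrite killingPl// hx hy mulr0 addr0.
by apply/eqP; apply: contrapT => /negP h; apply: k0; exists x, y, z.
Qed.

(** The cocycle [kap x y *: cls (a *: d b)]. It is alternating because
    [a *: d b + b *: d a] is exact, and the cocycle identity combines the invariance
    of [kap] with the Leibniz rule. *)
Lemma current_cocycle : exists Phi : {bilinear T -> T -> H},
  [/\ forall x a y b, Phi (tens x a) (tens y b) = kap x y *: cls (a *: d b),
      forall s s', Phi s s' = - Phi s' s &
      forall s1 s2 s3, Phi s1 (brT s2 s3) + Phi s2 (brT s3 s1) + Phi s3 (brT s1 s2) = 0].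
Proof.
have [clsl clsr] := cls_bilinear hd hcls.
have [y z|y z|Phi PhiE] := @tensor_lift2 _ _ _ _ _ hTens H
    (fun x a y b => kap x y *: cls (a *: d b)).
- split=> w k u v /=; first by rewrite killingPl// scalerDl /= scalerA.
  by rewrite /= clsl scalerDr !scalerA mulrC.
- split=> w k u v /=; first by rewrite killingPr// scalerDl /= scalerA.
  by rewrite /= clsr scalerDr !scalerA mulrC.
exists Phi; split=> // [s s'|].
  move: s; apply: (tensor_ind hTens) => [k x y hx hy|x a].
    by rewrite linearPl linearPr hx hy opprD scalerN.
  move: s'; apply: (tensor_ind hTens) => [k u v hu hv|y b].
    by rewrite linearPl linearPr hu hv opprD scalerN.
  by rewrite !PhiE killingC// (cls_anti hd hcls) scalerN.
have assemble k (a b c a' b' c' : H) : a + b + c = 0 -> a' + b' + c' = 0 ->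
    (k *: a + a') + (k *: b + b') + (k *: c + c') = 0.
  move=> h h'; rewrite (addrACA (k *: a)) (addrACA (k *: a + k *: b)) -!scalerDr.
  by rewrite h h' scaler0 addr0.
apply: (tensor_ind hTens) => [k s s' hs hs' s2 s3|x a].
  by rewrite !linearPl !linearPr /=; apply: assemble.
apply: (tensor_ind hTens) => [k s s' hs hs' s3|y b].
  by rewrite !linearPl !linearPr /=; apply: assemble.
apply: (tensor_ind hTens) => [k s s' hs hs'|z c].
  by rewrite !linearPl !linearPr /=; apply: assemble.
rewrite !brTE !PhiE.
have -> : kap y (br z x) = kap x (br y z) by rewrite -killing_assoc// killingC.
have -> : kap z (br x y) = kap x (br y z) by rewrite killingC// killing_assoc.
rewrite -2!scalerDr.
rewrite (cls_anti hd hcls a) (cls_anti hd hcls b) (cls_leibniz hd hcls c).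
by rewrite [c * b]mulrC -opprD (addrC (cls ((c * a) *: _))) addNr scaler0.
Qed.

Section Universal.
Variables (F : lmodType K) (brF : {bilinear F -> F -> F}) (rho : {linear F -> T}).
Hypothesis cF : central_extension brT brF rho.
Variable B : {bilinear T -> T -> F}.
Hypothesis rhoB : forall X Y, rho (B X Y) = brT X Y.
Hypothesis Banti : forall X Y, B X Y = - B Y X.
Hypothesis Bjac : forall X Y Z, B X (brT Y Z) = B (brT X Y) Z + B Y (brT X Z).

(** An equivariant linear section, written down with the Casimir element: applying
    [B] to [x = \sum_i [e_i, [f_i, x]]] gives the lift
    [\sum_i B (e_i (x) 1) ([f_i, x] (x) a)] of [x (x) a]. Its equivariance is the
    invariance of the Casimir tensor. *)
Lemma casimir_section : exists s : {linear T -> F},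
  (forall X, rho (s X) = X) /\ forall z x a, B (tens z 1) (tens x a) = s (tens (br z x) a).
Proof.
have [|s sE] := @tensor_lift _ _ _ _ _ hTens F
    (fun x a => \sum_(i < \dim {:g}) B (tens (e i) 1) (tens (br (f i) x) a)).
  split=> w k u v /=; rewrite scaler_sumr -big_split; apply: eq_bigr => i _ /=.
    by rewrite linearPr linearPl linearPr.
  by rewrite !linearPr.
exists s; split.
  apply: (tensor_ind hTens) => [k x y hx hy|x a]; first by rewrite !linearP hx hy.
  rewrite sE linear_sum; under eq_bigr => i _ do rewrite rhoB brTE mul1r.
  by rewrite -linear_sumlz casimir_id.
move=> z x a; rewrite sE -[in LHS](casimir_id hg x) linear_sumlz linear_sumr /=.
have [b bE] : exists b : {bilinear g -> g -> F},
    forall u v, b u v = B (tens u 1) (tens (br v x) a).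
  apply: bilinear_map; split=> w k u v /=; first by rewrite !linearPl.
  by rewrite linearPl linearPl linearPr.
have := casimir_invariant hg b z; rewrite big_split /= => /eqP; rewrite addr_eq0 => /eqP casi.
transitivity (\sum_(i < \dim {:g}) b (br z (e i)) (f i) +
  \sum_(i < \dim {:g}) B (tens (e i) 1) (tens (br z (br (f i) x)) a)).
  rewrite -big_split; apply: eq_bigr => i _ /=.
  have -> : tens (br (e i) (br (f i) x)) a = brT (tens (e i) 1) (tens (br (f i) x) a).
    by rewrite brTE mul1r.
  by rewrite Bjac !brTE bE !mul1r.
rewrite casi addrC -sumrN -big_split; apply: eq_bigr => i _ /=.
by rewrite bE -linearBr -linearBl (lie_jac brL z) opprB addrCA subrr addr0.
Qed.

(** The difference [c] between [B] and the equivariant section of the bracket is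
    [g]-invariant in each pair of coefficients [a], [b], hence equal to
    [kap x y *: psi a b]. Antisymmetry and the Jacobi identity for [c] are exactly the
    identities that make [psi] a cyclic cocycle. *)
Lemma invariant_part : exists2 s : {linear T -> F}, forall X, rho (s X) = X &
  exists psi : A -> A -> F,
  [/\ bilinear_for *:%R *:%R psi, forall a b, psi a b = - psi b a,
     forall a b c, psi a (b * c) = psi (a * b) c + psi (a * c) b,
     forall a b, rho (psi a b) = 0 &
     forall x a y b, B (tens x a) (tens y b) =
       s (tens (br x y) (a * b)) + kap x y *: psi a b].
Proof.
have [s [rs sB]] := casimir_section; exists s => //.
pose c X Y := B X Y - s (brT X Y).
have clin : bilinear_for *:%R *:%R c.
  split=> Z k X Y /=; rewrite /c ?linearPl ?linearPr /= linearP opprD addrACA.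
    by rewrite scalerBr.
  by rewrite scalerBr.
have [x0 [y0 k0]] := killing_eq1.
have cE x y a b : c (tens x a) (tens y b) = kap x y *: c (tens x0 a) (tens y0 b).
  have [c' c'E] : exists c' : {bilinear g -> g -> F},
      forall x y, c' x y = c (tens x a) (tens y b).
    apply: bilinear_map; split=> w k u v /=; first by rewrite linearPl clin.1.
    by rewrite linearPl clin.2.
  have [z u v|v vE] := invariant_form hg (c := c').
    rewrite !c'E /c !brTE addrACA -opprD -linearD -linearDl /=.
    have -> : br (br z u) v + br u (br z v) = br z (br u v).
      by rewrite (lie_jac brL z) subrK.
    rewrite -sB; have := Bjac (tens z 1) (tens u a) (tens v b).
    by rewrite !brTE !mul1r => ->; rewrite subrr.
  by rewrite -!c'E !vE k0 scale1r.
have canti X Y : c X Y = - c Y X.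
  by rewrite /c Banti (lie_anti brTL X) linearN opprB opprK addrC.
have cjac X Y Z : c X (brT Y Z) = c (brT X Y) Z + c Y (brT X Z).
  rewrite /c Bjac addrACA -opprD -linearD /=; congr (_ - s _).
  by rewrite (lie_jac brTL X) subrK.
exists (fun a b => c (tens x0 a) (tens y0 b)); split.
- by split=> w k u v /=; rewrite linearPr ?clin.1 ?clin.2.
- by move=> a b; rewrite canti cE killingC// k0 scale1r.
- move=> a b u; have [x [y [z xyz]]] := killing_br_neq0.
  have := cjac (tens x a) (tens y b) (tens z u); rewrite !brTE (cE x) (cE (br x y)) (cE y).
  have -> : kap y (br x z) = - kap (br x y) z.
    by rewrite -killing_assoc// (lie_anti brL y) killingNl.
  rewrite -killing_assoc// => h; apply: (scalerI xyz); rewrite h [RHS]scalerDr.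
  congr (_ + _); rewrite scaleNr -scalerN; congr (_ *: _).
  by rewrite canti opprK cE killingC// k0 scale1r.
- by move=> a b; rewrite /c linearB rhoB rs subrr.
- by move=> x a y b; rewrite -cE /c brTE addrC subrK.
Qed.

End Universal.

(** Kassel's theorem. For another central extension [F], the pair made of the
    section [s] and of the map [th] induced by [psi] is a morphism to [F].
    It is unique because two morphisms over [T] agree on brackets, and brackets
    span: [[x0 (x) a, y0 (x) b]] with [kap x0 y0 = 1] produces [cls (a *: d b)]
    modulo [T]. *)
Theorem kassel (Phi : {bilinear T -> T -> H})
    (brh : {bilinear (T * H)%type -> (T * H)%type -> (T * H)%type}) :
  (forall x a y b, Phi (tens x a) (tens y b) = kap x y *: cls (a *: d b)) ->
  (forall s s', Phi s s' = - Phi s' s) ->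
  (forall s1 s2 s3, Phi s1 (brT s2 s3) + Phi s2 (brT s3 s1) + Phi s3 (brT s1 s2) = 0) ->
  (forall z z', brh z z' = (brT z.1 z'.1, Phi z.1 z'.1)) ->
  universal_central_extension brT brh (fst : {linear (T * H)%type -> T}).
Proof.
move=> PhiE Panti Pcoc brhE.
have Phi0 s : Phi s s = 0 by apply: eq_opp_eq0; apply: Panti.
have [x0 [y0 k0]] := killing_eq1.
split.
  split=> [|z z'|X|z z0 z'].
  - split=> [z|z1 z2 z3]; first by rewrite brhE brTL.1 Phi0.
    by rewrite !brhE /= [LHS]/GRing.add /= /add_pair /= brTL.2 Pcoc.
  - by rewrite brhE.
  - by exists (X, 0).
  - by rewrite brhE z0 !linear0l.
move=> F brF rho cF; have [B [BE rhoB Banti Bjac]] := central_lift cF.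
have [s rs [psi [bpsi apsi lpsi rpsi BsE]]] := invariant_part rhoB Banti Bjac.
have [th thE] := cocycle_lift hd hcls bpsi apsi lpsi.
have rth h : rho (th h) = 0.
  move: h; apply: (mod_exact_ind hd hcls) => [k x y hx hy|a b].
    by rewrite !linearP hx hy scaler0 addr0.
  by rewrite thE.
have BsP X Y : B X Y = s (brT X Y) + th (Phi X Y).
  move: X; apply: (tensor_ind hTens) => [k x y hx hy|x a].
    by rewrite !linearPl hx hy !linearP scalerDr addrACA.
  move: Y; apply: (tensor_ind hTens) => [k u v hu hv|y b].
    by rewrite !linearPr hu hv !linearP scalerDr addrACA.
  by rewrite PhiE linearZ /= thE BsE brTE.
have [|f fE] := @linear_map K (T * H)%type F (fun z => s z.1 + th z.2).
  by move=> k z z'; rewrite /= !linearP scalerDr addrACA.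
have rf z : rho (f z) = z.1 by rewrite fE linearD /= rs rth addr0.
exists f; split=> [z z'|z|f' hf' rf' z].
- by rewrite BE !rf fE brhE /= BsP.
- exact: rf.
have PB u v : f' (brh u v) = f (brh u v).
  by rewrite hf' BE !rf' fE brhE /= BsP.
have PL k u v : f' u = f u -> f' v = f v -> f' (k *: u + v) = f (k *: u + v).
  by move=> hu hv; rewrite !linearP hu hv.
have PT X : f' (X, 0) = f (X, 0).
  have pL k (X1 X2 : T) : ((k *: X1 + X2, 0) : (T * H)%type) = k *: (X1, 0) + (X2, 0).
    by rewrite [RHS]/GRing.add /= /add_pair /= scaler0 addr0.
  move: X; apply: (tensor_ind hTens) => [k X1 X2 hX hY|x a].
    by rewrite pL PL.
  move: x; apply: (simple_perfect hg) => [k x y hx hy|x y].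
    by rewrite linearPl pL PL.
  have := PB (tens x a, 0) (tens y 1, 0).
  rewrite brhE /= brTE mulr1 PhiE -(scale1r (1 : A)) (derC hd) scaler0.
  by rewrite (cls0 hcls) scaler0.
have PH h : f' (0, h) = f (0, h).
  have pL k (X Y : H) : ((0, k *: X + Y) : (T * H)%type) = k *: (0, X) + (0, Y).
    by rewrite [RHS]/GRing.add /= /add_pair /= scaler0 addr0.
  move: h; apply: (mod_exact_ind hd hcls) => [k x y hx hy|a b].
    by rewrite pL PL.
  have -> : ((0, cls (a *: d b)) : (T * H)%type) =
      -1 *: (tens (br x0 y0) (a * b), 0) + brh (tens x0 a, 0) (tens y0 b, 0).
    rewrite brhE /= brTE PhiE k0 scale1r [RHS]/GRing.add /= /add_pair /=.
    by rewrite scaler0 add0r scaleN1r addNr.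
  by apply: PL.
have -> : z = 1 *: (z.1, 0) + (0, z.2).
  by case: z => X h; rewrite scale1r [RHS]/GRing.add /= /add_pair /= addr0 add0r.
exact: PL.
Qed.

End Kassel.

(** * A basis of the hyperelliptic ring *)

Section Subalgebra.
Variables (K : fieldType) (A : comAlgType K) (P : A -> Prop).
Hypotheses (P1 : P 1) (PL : forall a x y, P x -> P y -> P (a *: x + y))
  (PM : forall x y, P x -> P y -> P (x * y)).

Definition subalg_pred of P 1 & (forall a x y, P x -> P y -> P (a *: x + y))
  & (forall x y, P x -> P y -> P (x * y)) : {pred A} := fun x => `[< P x >].

Fact subalg_predP : GRing.subalg_closed (subalg_pred P1 PL PM).
Proof.
split=> [|a x y /asboolP Px /asboolP Py|x y /asboolP Px /asboolP Py]; apply/asboolP => //.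
  exact: PL.
exact: PM.
Qed.
HB.instance Definition _ := GRing.isSubalgClosed.Build K A (subalg_pred P1 PL PM) subalg_predP.

Record subalg_of := SubalgOf { subalg_val : A; _ : subalg_val \in subalg_pred P1 PL PM }.
HB.instance Definition _ := [isSub for subalg_val].
HB.instance Definition _ := [Choice of subalg_of by <:].
HB.instance Definition _ := [SubChoice_isSubAlgebra of subalg_of by <:].
HB.instance Definition _ := [SubNzRing_isSubComNzRing of subalg_of by <:].

Fact subalg_val_linear : linear subalg_val.
Proof. by []. Qed.
Fact subalg_val_monoid : monoid_morphism subalg_val.
Proof. by []. Qed.
HB.instance Definition _ := GRing.isSemilinear.Build K subalg_of A *:%R subalg_val
  (GRing.semilinear_linear subalg_val_linear).
HB.instance Definition _ := GRing.isMonoidMorphism.Build subalg_of A subalg_val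
  subalg_val_monoid.

End Subalgebra.

Lemma horner_algE (K : fieldType) (A : comAlgType K) (t : A) q :
  horner_alg t q = \sum_(i < size q) q`_i *: t ^+ i.
Proof.
rewrite -{1}[q]coefK poly_def linear_sum; apply: eq_bigr => i _.
by rewrite linearZ /= rmorphXn /= horner_algX mulr_algl.
Qed.

Lemma horner_alg_morph (K : fieldType) (A B : comAlgType K) (f : {lrmorphism A -> B}) t q :
  f (horner_alg t q) = horner_alg (f t) q.
Proof.
rewrite !horner_algE linear_sum; apply: eq_bigr => i _.
by rewrite linearZ /= rmorphXn.
Qed.

Lemma horner_alg_regular (K : fieldType) (z : K) q : horner_alg (z : K^o) q = q.[z].
Proof. by rewrite horner_algE horner_coef. Qed.

Lemma poly_eq0_off0 (K : numFieldType) (q : {poly K}) :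
  (forall z, z != 0 -> q.[z] = 0) -> q = 0.
Proof.
move=> q0; apply/eqP; apply: contrapT => /negP qn0.
pose rs : seq K := [seq n.+1%:R | n <- iota 0 (size q)].
have : (size rs < size q)%N.
  apply: max_poly_roots => //.
    by apply/allP => z /mapP[n _ ->]; rewrite rootE q0 ?pnatr_eq0.
  by rewrite map_inj_uniq ?iota_uniq// => m n /eqP; rewrite eqr_nat => /eqP [].
by rewrite size_map size_iota ltnn.
Qed.

Section HyperRing.
Variables (K : numClosedFieldType) (p : {poly K}) (R : comUnitAlgType K) (t u : R).
Hypotheses (p_neq0 : p != 0) (hR : is_hyper_ring p t u).

Local Notation ht := (horner_alg t).

Lemma t_unit : t \is a GRing.unit. Proof. by case: hR. Qed.
Lemma u_sqr : u * u = ht p. Proof. by case: hR => _ <-. Qed.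

Lemma hyper_gen (P : R -> Prop) : P 1 ->
  (forall a x y, P x -> P y -> P (a *: x + y)) ->
  (forall x y, P x -> P y -> P (x * y)) ->
  P t -> P t^-1 -> P u -> forall x, P x.
Proof.
move=> P1 PL PM Pt Ps Pu.
have mem x : P x -> x \in subalg_pred P1 PL PM by move=> Px; apply/asboolP.
pose B : comAlgType K := subalg_of P1 PL PM.
pose t1 : B := SubalgOf (mem _ Pt); pose s1 : B := SubalgOf (mem _ Ps).
pose u1 : B := SubalgOf (mem _ Pu).
have [_ u2 univ] := hR.
have [||f [ft fu _]] := univ B t1 s1 u1.
- by apply: val_inj; rewrite /= mulrV ?t_unit.
- apply: val_inj; rewrite rmorphXn /= u2.
  exact: esym (horner_alg_morph (@subalg_val _ _ _ P1 PL PM : {lrmorphism B -> R}) t1 p).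
have [||h [_ _ hU]] := univ R t t^-1 u; rewrite ?mulrV ?t_unit//.
pose f' : {lrmorphism R -> R} := (@subalg_val _ _ _ P1 PL PM) \o f.
move=> x; have -> : x = f' x.
  by rewrite (hU f') /= ?ft ?fu// -(hU idfun).
by have /asboolP := valP (f x).
Qed.

(** At each point [(z, v)] of the curve with [z != 0] the relation becomes
    [A.[z] + B.[z] * v = 0], and it also holds at [(z, - v)]. So [A] and [B * p] vanish
    at every [z != 0]. *)
Lemma hyper_indep (A B : {poly K}) : ht A + ht B * u = 0 -> A = 0 /\ B = 0.
Proof.
have [_ _ univ] := hR.
move=> AB0; have ev z v : z != 0 -> v ^+ 2 = p.[z] -> A.[z] + B.[z] * v = 0.
  move=> z0 vp; have [||f [ft fu _]] := univ K^o z z^-1 v.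
  - by rewrite mulfV.
  - by rewrite horner_alg_regular.
  have fE q : f (ht q) = q.[z].
    by rewrite -horner_alg_regular -ft; exact: (horner_alg_morph f t q).
  by have := congr1 f AB0; rewrite rmorphD rmorphM /= !fE fu rmorph0.
have ev2 z : z != 0 -> A.[z] = 0 /\ B.[z] * sqrtC p.[z] = 0.
  move=> z0; have e1 := ev z (sqrtC p.[z]) z0 (sqrtCK _).
  have := ev z (- sqrtC p.[z]) z0; rewrite sqrrN sqrtCK mulrN => /(_ erefl) e2.
  have A0 : A.[z] = 0.
    have : A.[z] *+ 2 = 0 by rewrite mulr2n -[RHS](addr0 0) -{1}e1 -e2 addrACA subrr addr0.
    by move/eqP; rewrite mulrn_eq0 => /eqP.
  by split=> //; move: e1; rewrite A0 add0r.
split; first by apply: poly_eq0_off0 => z /ev2[].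
suff /eqP : B * p = 0 by rewrite mulf_eq0 (negPf p_neq0) orbF => /eqP.
apply: poly_eq0_off0 => z /ev2[_] /eqP; rewrite mulf_eq0 sqrtC_eq0 => h.
by apply/eqP; rewrite hornerM mulf_eq0.
Qed.

(** [x] written as a Laurent polynomial in [t] plus another one times [u]: [A] and
    [B] are the numerators over the common denominator [t ^+ N]. *)
Definition hyper_rep x N (A B : {poly K}) := t ^+ N * x = ht A + ht B * u.

Lemma hyper_repD a x y N M A B C D : hyper_rep x N A B -> hyper_rep y M C D ->
  hyper_rep (a *: x + y) (N + M) (a *: ('X^M * A) + 'X^N * C) (a *: ('X^M * B) + 'X^N * D).
Proof.
rewrite /hyper_rep => hx hy.
have -> : t ^+ (N + M) * (a *: x + y) = a *: (t ^+ M * (t ^+ N * x)) + t ^+ N * (t ^+ M * y).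
  by rewrite !mulrA -!exprD (addnC M) mulrDr -scalerAr.
rewrite hx hy !rmorphD /= !linearZ /= !mulr_algl !rmorphM /= !rmorphXn /= !horner_algX.
by rewrite !mulrDr mulrDl scalerDr -!scalerAl !mulrA addrACA.
Qed.

Lemma hyper_rep_total x : exists N A B, hyper_rep x N A B.
Proof.
move: x; apply: hyper_gen.
- by exists 0%N, 1, 0; rewrite /hyper_rep !rmorph1 rmorph0 mul0r addr0 mulr1.
- move=> a x y [N [A [B hx]]] [M [C [D hy]]].
  by do 3![eexists]; apply: hyper_repD hx hy.
- move=> x y [N [A [B hx]]] [M [C [D hy]]].
  exists (N + M)%N, (A * C + B * D * p), (A * D + B * C).
  rewrite /hyper_rep exprD mulrACA hx hy !rmorphD !rmorphM /= -u_sqr.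
  by ring.
- by exists 0%N, 'X, 0; rewrite /hyper_rep expr0 horner_algX rmorph0 mul0r addr0 mul1r.
- by exists 1%N, 1, 0; rewrite /hyper_rep rmorph1 rmorph0 mul0r addr0 mulrV ?t_unit.
- by exists 0%N, 0, 1; rewrite /hyper_rep expr0 rmorph1 rmorph0 !mul1r add0r.
Qed.

Lemma hyper_ind (P : R -> Prop) :
  (forall a x y, P x -> P y -> P (a *: x + y)) ->
  (forall n : int, P (t ^ n)) -> (forall n : int, P (t ^ n * u)) -> forall x, P x.
Proof.
move=> PL Pt Pu x; have [N [A [B hx]]] := hyper_rep_total x.
have P0 : P 0 by rewrite -(addNr (t ^ 0)) -scaleN1r; apply: PL.
have PS I (r : seq I) (c : I -> K) F : (forall i, P (F i)) -> P (\sum_(i <- r) c i *: F i).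
  by move=> PF; apply: (big_rec P) => // i y _; apply: PL.
have -> : x = t ^ (- N%:Z) * (ht A + ht B * u).
  by rewrite -hx mulrA exprnP -exprzDr ?t_unit// addNr mul1r.
rewrite !horner_algE mulrDr !mulr_suml !mulr_sumr -[X in X + _]scale1r.
apply: PL.
  under eq_bigr => i _ do rewrite -scalerAr [t ^+ i]exprnP -exprzDr ?t_unit//.
  exact: PS.
under eq_bigr => i _ do rewrite -scalerAl -scalerAr [t ^+ i]exprnP mulrA -exprzDr ?t_unit//.
exact: PS.
Qed.

Section LaurentLift.
Variable V : lmodType K.
Implicit Types f h : int -> V.

(** The value on [t^-N A(t)] of the linear map sending [t^n] to [f n]. *)
Definition laurent_val f N (A : {poly K}) : V := \sum_(i < size A) A`_i *: f (i%:Z - N%:Z).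

Lemma laurent_valE f N (A : {poly K}) m : (size A <= m)%N ->
  laurent_val f N A = \sum_(i < m) A`_i *: f (i%:Z - N%:Z).
Proof.
move=> sA; rewrite /laurent_val (big_ord_widen m (fun i => A`_i *: f (i%:Z - N%:Z)))//.
rewrite big_mkcond; apply: eq_bigr => i _ /=; case: ltnP => // Ai.
by rewrite nth_default ?scale0r.
Qed.

Lemma laurent_valP f N c (A B : {poly K}) :
  laurent_val f N (c *: A + B) = c *: laurent_val f N A + laurent_val f N B.
Proof.
pose m := maxn (size A) (size B).
rewrite !(@laurent_valE _ _ _ m) ?leq_maxl ?leq_maxr//; last first.
  apply: leq_trans (size_polyD _ _) _; rewrite geq_max leq_maxr andbT.
  by apply: leq_trans (size_scale_leq _ _) _; rewrite leq_maxl.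
rewrite scaler_sumr -big_split; apply: eq_bigr => i _ /=.
by rewrite coefD coefZ scalerDl scalerA.
Qed.

Lemma laurent_val_shift f N k (A : {poly K}) : laurent_val f (N + k) ('X^k * A) = laurent_val f N A.
Proof.
rewrite (@laurent_valE _ _ _ (k + size A)); last first.
  by apply: leq_trans (size_polyMleq _ _) _; rewrite size_polyXn.
rewrite big_split_ord big1 /= ?add0r; last first.
  by move=> i _; rewrite coefXnM ltn_ord scale0r.
apply: eq_bigr => i _; rewrite coefXnM ltnNge leq_addr /= addKn.
by congr (_ *: f _); lia.
Qed.

Lemma laurent_val_mono f N n (i : nat) : i%:Z - N%:Z = n -> laurent_val f N 'X^i = f n.
Proof.
move=> <-; rewrite /laurent_val size_polyXn big_ord_recr /= big1 ?add0r => [|j _].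
  by rewrite coefXn eqxx scale1r.
by rewrite coefXn ltn_eqF ?ltn_ord ?scale0r.
Qed.

Lemma hyper_rep_val f h x N M A B C D : hyper_rep x N A B -> hyper_rep x M C D ->
  laurent_val f N A + laurent_val h N B = laurent_val f M C + laurent_val h M D.
Proof.
move=> hx hy; have := hyper_repD (-1) hx hy.
rewrite /hyper_rep scaleN1r addNr mulr0 => /esym /hyper_indep[].
rewrite !scaleN1r => /eqP; rewrite addr_eq0 eqr_opp => /eqP e1 /eqP.
rewrite addr_eq0 eqr_opp => /eqP e2.
by rewrite -(laurent_val_shift f N M) e1 -(laurent_val_shift h N M) e2 addnC !laurent_val_shift.
Qed.

(** The [t ^ n] and [t ^ n * u] form a basis of [R], in the form of an extension
    property. *)
Lemma laurent_lift f h : exists L : {linear R -> V},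
  (forall n : int, L (t ^ n) = f n) /\ (forall n : int, L (t ^ n * u) = h n).
Proof.
have /choice[v vP] x : exists v, exists N A B, hyper_rep x N A B /\
    v = laurent_val f N A + laurent_val h N B.
  by have [N [A [B hx]]] := hyper_rep_total x; do 4![eexists]; split; [exact: hx|].
have vE x N A B : hyper_rep x N A B -> v x = laurent_val f N A + laurent_val h N B.
  by move=> hx; have [N' [A' [B' [hx' ->]]]] := vP x; apply: hyper_rep_val hx' hx.
have [|L LE] := @linear_map K R V v.
  move=> c x y; have [N [A [B [hx ->]]]] := vP x; have [M [C [D [hy ->]]]] := vP y.
  rewrite (vE _ _ _ _ (hyper_repD c hx hy)) !laurent_valP !laurent_val_shift.
  by rewrite addnC !laurent_val_shift scalerDr addrACA.
(* [t ^ n] is [t ^+ (n + |n|)] over the denominator [t ^+ |n|] *)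
exists L; split=> n; rewrite LE.
  rewrite (vE _ (absz n) 'X^(absz (n + (absz n)%:Z)) 0); last first.
    rewrite /hyper_rep rmorph0 mul0r addr0 rmorphXn /= horner_algX.
    by rewrite !exprnP -exprzDr ?t_unit//; congr (_ ^ _); lia.
  have -> : laurent_val h (absz n) 0 = 0 by rewrite /laurent_val size_poly0 big_ord0.
  by rewrite addr0 (@laurent_val_mono _ _ n)//; lia.
rewrite (vE _ (absz n) 0 'X^(absz (n + (absz n)%:Z))); last first.
  rewrite /hyper_rep rmorph0 add0r rmorphXn /= horner_algX mulrA.
  by rewrite !exprnP -exprzDr ?t_unit//; congr (_ ^ _ * _); lia.
have -> : laurent_val f (absz n) 0 = 0 by rewrite /laurent_val size_poly0 big_ord0.
by rewrite add0r (@laurent_val_mono _ _ n)//; lia.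
Qed.

End LaurentLift.

End HyperRing.

(** * Differentials modulo exact ones on a hyperelliptic curve *)

Section HyperPoly.
Variables (K : fieldType) (r : nat) (alpha : 'I_r -> K).
Hypothesis alpha_neq0 : forall i, alpha i != 0.
Local Notation p := (hyper_poly alpha).

Lemma size_hyper_poly : size p = r.+2.
Proof.
rewrite /hyper_poly mulrC size_mulX ?monic_neq0 ?monic_prod_XsubC//.
by rewrite size_prod_XsubC /index_enum -enumT size_enum_ord.
Qed.

Lemma hyper_poly_coef0 : p`_0 = 0. Proof. by rewrite coefXM. Qed.

Lemma hyper_poly_coef1 : p`_1 != 0.
Proof.
rewrite coefXM /= -horner_coef0 horner_prod prodf_seq_neq0.
by apply/allP => i _ /=; rewrite hornerXsubC sub0r oppr_eq0.
Qed.

Lemma hyper_poly_lead : p`_r.+1 = 1.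
Proof.
have : p \is monic by rewrite monicMl ?monicX// monic_prod_XsubC.
by rewrite monicE lead_coefE size_hyper_poly => /eqP.
Qed.

Lemma hyper_poly_neq0 : p != 0.
Proof. by rewrite -size_poly_eq0 size_hyper_poly. Qed.

Lemma horner_hyper_poly (A : comAlgType K) (t : A) :
  horner_alg t p = \sum_(1 <= k < r.+2) p`_k *: t ^+ k.
Proof.
rewrite horner_algE size_hyper_poly -(big_mkord predT (fun i => p`_i *: t ^+ i)).
by rewrite big_ltn// hyper_poly_coef0 scale0r add0r.
Qed.

End HyperPoly.

Section Recurrence.
Variables (K : numFieldType) (r : nat) (alpha : 'I_r -> K).
Local Notation p := (hyper_poly alpha).
Local Notation a k := (p`_k).

(** A sequence subject to the recurrence is determined by its values at
    [-r, ..., -1]: the coefficient [2n + r + 3] of the last term does not vanish for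
    [n >= 0], which gives the terms to the right, and the coefficient [(2n + 3) a_1] of
    the first term never does, which gives those to the left. *)
Lemma ocls_unique (V : lmodType K) (o : int -> V) :
  p`_1 != 0 -> p`_r.+1 = 1 ->
  (forall i : int, \sum_(1 <= j < r.+2) ((2 * i + 3 * j%:Z)%:~R * a j) *: o (i + j%:Z - 1) = 0) ->
  (forall n : int, - r%:Z <= n < 0 -> o n = 0) -> forall n, o n = 0.
Proof.
move=> a1 ar orec o0.
have fw (N : nat) n : - r%:Z <= n < N%:Z -> o n = 0.
  elim: N n => [|N IH] n; first exact: o0.
  move=> /andP[n1 n2]; have [nN|nN] := ltP n N%:Z; first by apply: IH; rewrite n1.
  have {n2 nN} nE : n = N%:Z by lia.
  have := orec (n - r%:Z); rewrite big_nat_recr//= big_nat_cond big1 ?add0r; last first.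
    by move=> j /andP[/andP[j1 j2] _]; rewrite (IH _ _) ?scaler0//; lia.
  rewrite ar mulr1; have -> : n - r%:Z + r.+1%:Z - 1 = n by lia.
  by move/eqP; rewrite scaler_eq0 intr_eq0 => /orP[/eqP|/eqP//]; lia.
have bw (N : nat) n : - r%:Z - N%:Z <= n -> o n = 0.
  elim: N n => [|N IH] n n1.
    by apply: (fw (absz n).+1); lia.
  have [nN|nN] := leP (- r%:Z - N%:Z) n; first exact: IH.
  have := orec n; rewrite big_ltn// big_nat_cond [X in _ + X]big1 ?addr0; last first.
    by move=> j /andP[/andP[j1 j2] _]; rewrite (IH _ _) ?scaler0//; lia.
  have -> : n + 1%N%:Z - 1 = n by lia.
  move/eqP; rewrite scaler_eq0 mulf_eq0 (negPf a1) orbF intr_eq0 => /orP[/eqP|/eqP//].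
  lia.
by move=> n; apply: (bw (absz n)); lia.
Qed.

(** The coordinate on [omega_k] of the class of [t^n u dt], for every [n]: the two
    families [P] and [Q] are the right and left halves of one sequence. *)
Definition ocoef (k : nat) (n : int) : K :=
  if - r%:Z <= n then Pcoef r (fun k => a k) n (- k%:Z) else Qcoef r (fun k => a k) (- n) (- k%:Z).

Lemma ocoef_base k n : - r%:Z <= n < 0 -> ocoef k n = (n == - k%:Z)%:R.
Proof. by move=> /andP[n1 n2]; rewrite /ocoef n1 PcoefE_lt0. Qed.

(** The two halves agree where both are initial values, so that a relation
    straddling [-r] can be read on [Q] alone. *)
Lemma ocoef_lt0 k n : n < 0 -> ocoef k n = Qcoef r (fun k => a k) (- n) (- k%:Z).
Proof.
move=> n0; rewrite /ocoef; case: ifP => // n1.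
rewrite PcoefE_lt0// QcoefE_le; last by lia.
by rewrite eqr_opp.
Qed.

Lemma ocoef_rec k (i : int) : (0 < r)%N -> p`_1 != 0 -> p`_r.+1 = 1 ->
  \sum_(1 <= j < r.+2) (2 * i + 3 * j%:Z)%:~R * a j * ocoef k (i + j%:Z - 1) = 0.
Proof.
move=> r0 a1 ar; have [ir|ir] := leP (- r%:Z) i.
  rewrite big_nat_recr//= ar mulr1.
  have := @PcoefE_ge0 K r (fun k => a k) (- k%:Z) (i + r%:Z); rewrite -[_ <= _]/(0 <= i + r%:Z).
  have i0 : 0 <= i + r%:Z by lia.
  move=> /(_ i0) e.
  have -> : ocoef k (i + r.+1%:Z - 1) = Pcoef r (fun k => a k) (i + r%:Z) (- k%:Z).
    have -> : i + r.+1%:Z - 1 = i + r%:Z by lia.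
    rewrite /ocoef. case: ifP => // /negP []. lia.
  have -> : 2 * i + 3 * r.+1%:Z = 2 * (i + r%:Z) + r%:Z + 3 by lia.
  rewrite e -sumrB big_nat_cond big1// => j /andP[/andP[j1 j2] _].
  have -> : 3 * j%:Z + 2 * (i + r%:Z) - 2 * r%:Z = 2 * i + 3 * j%:Z by lia.
  have -> : i + r%:Z - r%:Z + j%:Z - 1 = i + j%:Z - 1 by lia.
  by rewrite /ocoef; case: ifP => [_|/negP []]; [rewrite subrr|lia].
rewrite big_ltn//.
have := @QcoefE_gt K r (fun k => a k) (- k%:Z) (- i) r0 a1.
have mi : r%:Z < - i by lia.
move=> /(_ mi) e.
rewrite ocoef_lt0; last by lia.
have -> : - (i + 1%N%:Z - 1) = - i by lia.
have -> : 2 * i + 3 * 1%N%:Z = - (2 * - i - 3) by lia.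
rewrite mulrNz !mulNr e addrC -sumrB big_nat_cond big1// => j /andP[/andP[j1 j2] _].
rewrite ocoef_lt0; last by lia.
have -> : - (i + j%:Z - 1) = - i - j%:Z + 1 by lia.
have -> : 3 * j%:Z - 2 * - i = 2 * i + 3 * j%:Z by lia.
by rewrite subrr.
Qed.

End Recurrence.

Section Calculus.
Variables (K : numFieldType) (r : nat) (alpha : 'I_r -> K).
Local Notation p := (hyper_poly alpha).
Local Notation a k := (p`_k).
Variables (R : comUnitAlgType K) (t u : R) (hR : is_hyper_ring p t u).
Variables (Om : lmodType R) (d : R -> Om) (hd : is_kaehler d).
Variables (H : lmodType K) (cls : Om -> H) (hcls : is_mod_exact d cls).

Let tU : t \is a GRing.unit. Proof. by case: hR. Qed.
Let u2 : u * u = horner_alg t p. Proof. by case: hR => _ <-. Qed.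

Definition ecls (n : int) : H := cls (t ^ n *: d t).
Definition ocls (n : int) : H := cls ((t ^ n * u) *: d t).

Lemma cls_int (n : int) w : cls (n%:~R *: w) = n%:~R *: cls w.
Proof. by rewrite -(clsZ hcls) -(rmorph_int (in_alg R)). Qed.

Lemma der_texp (n : int) : d (t ^ n) = n%:~R *: (t ^ (n - 1) *: d t).
Proof.
have step m : d (t ^ (m + 1)) = t ^ m *: d t + t *: d (t ^ m).
  by rewrite exprzDr// expr1z (derM hd).
have texp m : t *: (t ^ (m - 1) *: d t) = t ^ m *: d t.
  by rewrite scalerA -{1}(expr1z t) -exprzDr// addrC subrK.
elim/int_ind: n => [|n IH|n IH].
- by rewrite expr0z scale0r -(scale1r (1 : R)) (derC hd).
- rewrite -addn1 PoszD step IH scalerA [t * _]mulrC -scalerA texp addrK.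
  by rewrite intrD scalerDl scale1r addrC.
have := step (- n.+1%:Z); have -> : - n.+1%:Z + 1 = - n%:Z by lia.
rewrite IH [t ^ _ *: _ + _]addrC => /eqP; rewrite -subr_eq => /eqP e.
have tK : cancel (fun w : Om => t *: w) (fun w => t^-1 *: w).
  by move=> w; rewrite scalerA mulVr// scale1r.
apply: (can_inj tK) => /=; rewrite -e [RHS]scalerA [t * _]mulrC -[RHS]scalerA texp.
have -> : - n%:Z - 1 = - n.+1%:Z by lia.
rewrite -[X in _ - X]scale1r -scalerBl; congr (_ *: _).
by rewrite -[X in _ - X]/(1%:~R) -intrB; congr (_%:~R); lia.
Qed.

Lemma cls_tt (i j : int) : cls (t ^ i *: d (t ^ j)) = j%:~R *: ecls (i + j - 1).
Proof.
by rewrite der_texp scalerA mulrC -scalerA cls_int scalerA -exprzDr// addrA.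
Qed.

Lemma cls_ut (i j : int) : cls ((t ^ i * u) *: d (t ^ j)) = j%:~R *: ocls (i + j - 1).
Proof.
rewrite der_texp scalerA mulrC -scalerA cls_int scalerA mulrAC -exprzDr//.
by rewrite addrA.
Qed.

Lemma ecls_eq0 n : n != -1 -> ecls n = 0.
Proof.
move=> n1; have : (n + 1)%:~R *: ecls n = 0.
  by have := cls_tt 0 (n + 1); rewrite expr0z scale1r (cls_exact hcls) add0r addrK => <-.
by move=> /eqP; rewrite scaler_eq0 intr_eq0 addr_eq0 (negPf n1) => /eqP.
Qed.

Lemma texp_hyper (n : int) : t ^ n * horner_alg t p = \sum_(1 <= k < r.+2) a k *: t ^ (n + k%:Z).
Proof.
rewrite horner_hyper_poly mulr_sumr; apply: eq_bigr => k _.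
by rewrite -scalerAr exprnP -exprzDr.
Qed.

Lemma der_hyper : d (horner_alg t p) =
  \sum_(1 <= k < r.+2) (a k * k%:R)%:A *: (t ^ (k%:Z - 1) *: d t).
Proof.
rewrite horner_hyper_poly.
have d0 : d 0 = 0 by rewrite -(scale0r (1 : R)) (derC hd).
rewrite (big_morph d (derD hd) d0); apply: eq_bigr => k _.
rewrite (derZ hd) exprnP der_texp scalerA; congr (_ *: _).
by rewrite -[_%:~R](rmorph_int (in_alg R)) /= -scalerAl mul1r scalerA.
Qed.

Lemma two_u_du : 2%:R *: (u *: d u) = d (horner_alg t p).
Proof. by rewrite -u2 (derM hd) scaler_nat mulr2n. Qed.

Lemma cls_hyper (n : int) w : cls ((t ^ n * horner_alg t p) *: w) =
  \sum_(1 <= k < r.+2) a k *: cls (t ^ (n + k%:Z) *: w).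
Proof.
rewrite texp_hyper scaler_suml (cls_sum hcls); apply: eq_bigr => k _.
by rewrite -mulr_algl -scalerA (clsZ hcls).
Qed.

Lemma cls_der_hyper x : cls (x *: d (horner_alg t p)) =
  \sum_(1 <= k < r.+2) (a k * k%:R) *: cls ((t ^ (k%:Z - 1) * x) *: d t).
Proof.
rewrite der_hyper scaler_sumr (cls_sum hcls); apply: eq_bigr => k _.
by rewrite scalerA [x * _]mulrC -[(_ * x) *: _]scalerA (clsZ hcls) scalerA [x * _]mulrC.
Qed.

(** Since [2 u du = p'(t) dt], the term [t^(i+j) u du] contributes the coefficients
    [k / 2], and [j t^(i+j-1) u^2 dt] the coefficients [j]. *)
Lemma cls_uu (i j : int) : cls ((t ^ i * u) *: d (t ^ j * u)) =
  \sum_(1 <= k < r.+2) ((j%:~R + 2^-1 * k%:R) * a k) *: ecls (i + j + k%:Z - 1).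
Proof.
have [h hE] : exists h : R, h = (2^-1 : K)%:A by eexists.
have half : h * 2%:R = 1.
  rewrite hE.
  by rewrite mulr_natr scalerMnl -mulr_natr mulVf ?pnatr_eq0// scale1r.
rewrite (derM hd) scalerDr (clsD hcls).
have -> : (t ^ i * u) *: (t ^ j *: d u) = h *: (t ^ (i + j) *: d (horner_alg t p)).
  rewrite -two_u_du !scalerA exprzDr//; congr (_ *: _).
  transitivity (h * 2%:R * (t ^ i * u * t ^ j)); [by rewrite half mul1r|by ring].
rewrite der_texp.
have -> : (t ^ i * u) *: (u *: (j%:~R *: (t ^ (j - 1) *: d t))) =
    j%:~R *: ((t ^ (i + j - 1) * horner_alg t p) *: d t).
  rewrite -u2 !scalerA -addrA (exprzDr tU i); congr (_ *: _); by ring.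
rewrite hE (clsZ hcls) cls_der_hyper cls_int cls_hyper !scaler_sumr -big_split.
apply: eq_bigr => k _ /=; rewrite -exprzDr// !scalerA.
have -> : k%:Z - 1 + (i + j) = i + j + k%:Z - 1 by lia.
have -> : i + j - 1 + k%:Z = i + j + k%:Z - 1 by lia.
rewrite -scalerDl; congr (_ *: _); by ring.
Qed.

(** The class of [t^i u (2 u du - p'(t) dt) = 0], rewritten with
    [t^n du = - n t^(n-1) u dt] modulo exact differentials. It is the relation
    [d(t^i u^3) = 0] up to a scalar. *)
Lemma ocls_rec (i : int) :
  \sum_(1 <= j < r.+2) ((2 * i + 3 * j%:Z)%:~R * a j) *: ocls (i + j%:Z - 1) = 0.
Proof.
have : cls ((t ^ i * u) *: (2%:R *: (u *: d u))) = 2%:R *: cls ((t ^ i * horner_alg t p) *: d u).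
  rewrite -[2%:R *: cls _](cls_int 2); congr cls; rewrite -u2 !scalerA; congr (_ *: _).
  by ring.
rewrite two_u_du cls_der_hyper cls_hyper scaler_sumr => /eqP.
rewrite -subr_eq0 -sumrB => /eqP e; rewrite -[RHS]e; apply: eq_bigr => j _.
rewrite (cls_anti hd hcls _ u); have := cls_ut 0 (i + j%:Z).
rewrite expr0z mul1r add0r => ->; rewrite mulrA -exprzDr// -/(ocls _).
have -> : j%:Z - 1 + i = i + j%:Z - 1 by lia.
rewrite !scalerN !scalerA opprK -scalerDl; congr (_ *: _).
by rewrite !intrD !intrM; ring.
Qed.

End Calculus.

(** * Linear forms on the differentials modulo exact ones *)

Section Functional.
Variables (K : numClosedFieldType) (r : nat) (alpha : 'I_r -> K).
Local Notation p := (hyper_poly alpha).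
Local Notation a k := (p`_k).
Variables (R : comUnitAlgType K) (t u : R) (hR : is_hyper_ring p t u).
Variables (Om : lmodType R) (d : R -> Om) (hd : is_kaehler d).
Variables (H : lmodType K) (cls : Om -> H) (hcls : is_mod_exact d cls).

Variables (le lo : int -> K).
Hypothesis le0 : forall n, n != -1 -> le n = 0.
Hypothesis lo_rec : forall i : int,
  \sum_(1 <= j < r.+2) (2 * i + 3 * j%:Z)%:~R * a j * lo (i + j%:Z - 1) = 0.

Let tU : t \is a GRing.unit. Proof. by case: hR. Qed.
Let u2 : u * u = horner_alg t p. Proof. by case: hR => _ <-. Qed.

(** The value on [(t^i u, t^j u)] forced by [2 u du = p'(t) dt]. *)
Definition uu_val (i j : int) : K :=
  \sum_(1 <= k < r.+2) ((j%:~R + 2^-1 * k%:R) * a k) * le (i + j + k%:Z - 1).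

(** The pairing [(x, y) |-> th (x dy)] of a linear form [th] on [Omega / dR], written
    on the basis of [R] from the values [le n] and [lo n] of [th] on [t^n dt] and
    [t^n u dt]. *)
Lemma hyper_pairing : exists psi : {bilinear R -> R -> K^o},
  [/\ forall i j : int, psi (t ^ i) (t ^ j) = j%:~R * le (i + j - 1),
      forall i j : int, psi (t ^ i * u) (t ^ j) = j%:~R * lo (i + j - 1),
      forall i j : int, psi (t ^ i) (t ^ j * u) = - (i%:~R * lo (i + j - 1)) &
      forall i j : int, psi (t ^ i * u) (t ^ j * u) = uu_val i j].
Proof.
have lift := laurent_lift (hyper_poly_neq0 alpha) hR.
have /choice[L1 L1E] (j : int) := lift K^o (fun i => j%:~R * le (i + j - 1)) (fun i => j%:~R * lo (i + j - 1)).
have /choice[L2 L2E] (j : int) := lift K^o (fun i => - (i%:~R * lo (i + j - 1))) (fun i => uu_val i j).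
have [F [FE GE]] := lift (R -> K^o : lmodType K) (fun j => L1 j : R -> K^o) (fun j => L2 j : R -> K^o).
have [|psi psiE] := @bilinear_map K R R K^o (fun x y => F y x).
  split=> z k x y; last by rewrite linearP.
  move: z; apply: (hyper_ind hR) => [c z z' hz hz'|n|n].
  - rewrite linearP -[LHS]/(c *: F z _ + F z' _) hz hz'.
    rewrite -[RHS]/(k *: (c *: F z x + F z' x) + (c *: F z y + F z' y)).
    by rewrite !scalerDr !scalerA mulrC addrACA.
  - by rewrite FE linearP.
  - by rewrite GE linearP.
exists psi; split=> i j; rewrite psiE ?FE ?GE.
- by case: (L1E j) => ->.
- by case: (L1E j) => _ ->.
- by case: (L2E j) => ->.
- by case: (L2E j) => _ ->.
Qed.

(** Any values satisfying [le n = 0] for [n != -1] and the recurrence on [lo] are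
    those of a linear form. The Leibniz rule is checked on basis elements; the
    hypothesis on [le] enters in the antisymmetry, and the recurrence on [lo] exactly
    in the case where all three elements contain [u]. *)
Lemma hyper_functional : exists th : {linear H -> K^o},
  (forall n, th (ecls t d cls n) = le n) /\ (forall n, th (ocls t u d cls n) = lo n).
Proof.
have [psi [v1 v2 v3 v4]] := hyper_pairing.
have half : (2^-1 : K) + 2^-1 = 1 by rewrite -mulr2n -[LHS]mulr_natr mulVf ?pnatr_eq0.
have nle n : n%:~R * le (n - 1) = 0.
  have [->|n0] := eqVneq n 0; first by rewrite mul0r.
  by rewrite le0 ?mulr0//; lia.
have vpr x n : psi x (t ^ n * horner_alg t p) =
    \sum_(1 <= k < r.+2) a k * psi x (t ^ (n + k%:Z)).
  rewrite (texp_hyper hR) linear_sumr; apply: eq_bigr => k _; exact: linearZr_LR.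
have vpl x n : psi (t ^ n * horner_alg t p) x =
    \sum_(1 <= k < r.+2) a k * psi (t ^ (n + k%:Z)) x.
  rewrite (texp_hyper hR) linear_sumlz; apply: eq_bigr => k _; exact: linearZl_LR.
have tt i j : t ^ i * t ^ j = t ^ (i + j) by rewrite exprzDr.
have ttu i j : t ^ i * (t ^ j * u) = t ^ (i + j) * u by rewrite mulrA tt.
have tut i j : (t ^ i * u) * t ^ j = t ^ (i + j) * u by rewrite mulrAC tt.
have tutu i j : (t ^ i * u) * (t ^ j * u) = t ^ (i + j) * horner_alg t p.
  by rewrite -u2 -tt mulrACA.
have anti x y : psi x y = - psi y x.
  move: x; apply: (hyper_ind hR) => [k x x' hx hx'|i|i].
  - by rewrite linearPl linearPr hx hx' opprD scalerN.
  - move: y; apply: (hyper_ind hR) => [k x x' hx hx'|j|j].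
    + by rewrite linearPl linearPr hx hx' opprD scalerN.
    + rewrite !v1 (addrC j i); apply/eqP; rewrite -addr_eq0 -mulrDl -intrD.
      by rewrite (addrC j i) nle.
    + by rewrite v3 v2 (addrC j i).
  - move: y; apply: (hyper_ind hR) => [k x x' hx hx'|j|j].
    + by rewrite linearPl linearPr hx hx' opprD scalerN.
    + by rewrite v3 v2 opprK (addrC j i).
    rewrite !v4 /uu_val; apply/eqP; rewrite -addr_eq0 -big_split big1//= => k _.
    rewrite (addrC j i) -mulrDl -mulrDl addrACA -mulrDl half mul1r.
    have -> : j%:~R + i%:~R + k%:R = (i + j + k%:Z)%:~R :> K by rewrite !intrD; ring.
    by rewrite mulrAC nle mul0r.
(* the shape of the linearity step in each of the three arguments *)
have asm k (x y z x' y' z' : K^o) : x = y + z -> x' = y' + z' ->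
    k *: x + x' = (k *: y + y') + (k *: z + z').
  by move=> -> ->; rewrite scalerDr addrACA.
have leib x y z : psi x (y * z) = psi (x * y) z + psi (x * z) y.
  move: x; apply: (hyper_ind hR) => [k x x' hx hx'|i|i].
  - by rewrite !mulrDl -!scalerAl !linearPl; apply: asm.
  - move: y; apply: (hyper_ind hR) => [k y y' hy hy'|j|j].
    + by rewrite mulrDl mulrDr -scalerAl -scalerAr linearPl !linearPr; apply: asm.
    + move: z; apply: (hyper_ind hR) => [k z z' hz hz'|l|l].
      * by rewrite !mulrDr -!scalerAr linearPl !linearPr; apply: asm.
      * rewrite !tt !v1.
        have -> : i + (j + l) - 1 = i + j + l - 1 by lia.
        have -> : i + l + j - 1 = i + j + l - 1 by lia.
        by rewrite intrD; ring.
      * rewrite !ttu tt v3 v3 v2.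
        have -> : i + (j + l) - 1 = i + j + l - 1 by lia.
        have -> : i + l + j - 1 = i + j + l - 1 by lia.
        by rewrite intrD; ring.
    + move: z; apply: (hyper_ind hR) => [k z z' hz hz'|l|l].
      * by rewrite !mulrDr -!scalerAr linearPl !linearPr; apply: asm.
      * rewrite tut ttu tt v3 v2 v3.
        have -> : i + (j + l) - 1 = i + j + l - 1 by lia.
        have -> : i + l + j - 1 = i + j + l - 1 by lia.
        by rewrite intrD; ring.
      * rewrite tutu !ttu vpr !v4 /uu_val -big_split; apply: eq_bigr => k _ /=.
        rewrite v1.
        have -> : i + (j + l + k%:Z) - 1 = i + j + l + k%:Z - 1 by lia.
        have -> : i + l + j + k%:Z - 1 = i + j + l + k%:Z - 1 by lia.
        rewrite -!mulrDl addrACA -mulrDl half !intrD; ring.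
  - move: y; apply: (hyper_ind hR) => [k y y' hy hy'|j|j].
    + by rewrite mulrDl mulrDr -scalerAl -scalerAr linearPl !linearPr; apply: asm.
    + move: z; apply: (hyper_ind hR) => [k z z' hz hz'|l|l].
      * by rewrite !mulrDr -!scalerAr linearPl !linearPr; apply: asm.
      * rewrite tt !tut !v2.
        have -> : i + (j + l) - 1 = i + j + l - 1 by lia.
        have -> : i + l + j - 1 = i + j + l - 1 by lia.
        by rewrite intrD; ring.
      * rewrite ttu tut tutu vpl !v4 /uu_val -big_split; apply: eq_bigr => k _ /=.
        rewrite v1.
        have -> : i + (j + l) + k%:Z - 1 = i + j + l + k%:Z - 1 by lia.
        have -> : i + l + k%:Z + j - 1 = i + j + l + k%:Z - 1 by lia.
        by rewrite !intrD; ring.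
    + move: z; apply: (hyper_ind hR) => [k z z' hz hz'|l|l].
      * by rewrite !mulrDr -!scalerAr linearPl !linearPr; apply: asm.
      * rewrite !tut tutu vpl !v4 /uu_val -big_split; apply: eq_bigr => k _ /=.
        rewrite v1.
        have -> : i + (j + l) + k%:Z - 1 = i + j + l + k%:Z - 1 by lia.
        have -> : i + j + k%:Z + l - 1 = i + j + l + k%:Z - 1 by lia.
        have -> : i + l + j + k%:Z - 1 = i + j + l + k%:Z - 1 by lia.
        by rewrite !intrD; ring.
      * rewrite !tutu vpr !vpl; apply/eqP; rewrite -subr_eq0; apply/eqP.
        rewrite -[RHS](lo_rec (i + j + l)) opprD addrA -!sumrB; apply: eq_bigr => k _ /=.
        rewrite v2 !v3.
        have -> : i + (j + l + k%:Z) - 1 = i + j + l + k%:Z - 1 by lia.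
        have -> : i + j + k%:Z + l - 1 = i + j + l + k%:Z - 1 by lia.
        have -> : i + l + k%:Z + j - 1 = i + j + l + k%:Z - 1 by lia.
        by rewrite !intrD !intrM; ring.
have [|th thE] := @cocycle_lift _ _ _ _ _ hd _ _ hcls (fun x y => psi x y) _ anti leib.
  by split=> z k x y; rewrite ?linearPl ?linearPr.
exists th; split=> n.
  by have := thE (t ^ n) (t ^ 1); rewrite v1 mul1r addrK => <-; rewrite expr1z.
by have := thE (t ^ n * u) (t ^ 1); rewrite v2 mul1r addrK => <-; rewrite expr1z.
Qed.

End Functional.

(** * The basis of the centre, the grading, and the theorem *)

Section LinSpan.
Variables (K : fieldType) (V W M : lmodType K).

Lemma lin_span_gen (S : V -> Prop) v : S v -> lin_span S v.
Proof.
move=> Sv; exists 1%N, (fun=> 1), (fun=> v); split=> //.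
by rewrite big_ord1 scale1r.
Qed.

Lemma lin_span0 (S : V -> Prop) : lin_span S 0.
Proof. by exists 0%N, (fun=> 0), (fun=> 0); split=> [[]|]; rewrite ?big_ord0. Qed.

Lemma lin_span_lin (S : V -> Prop) c v w :
  lin_span S v -> lin_span S w -> lin_span S (c *: v + w).
Proof.
move=> [n [a [s [sS ->]]]] [m [b [s' [s'S ->]]]].
exists (n + m)%N,
  (fun i => match fintype.split i with inl j => c * a j | inr j => b j end),
  (fun i => match fintype.split i with inl j => s j | inr j => s' j end).
split=> [i|]; first by case: fintype.split.
rewrite big_split_ord scaler_sumr; congr (_ + _); apply: eq_bigr => i _.
  by rewrite (unsplitK (inl i)) scalerA.
by rewrite (unsplitK (inr i)).
Qed.

Lemma lin_span_ind (S P : V -> Prop) : P 0 ->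
  (forall c v w, P v -> P w -> P (c *: v + w)) ->
  (forall v, S v -> P v) -> forall v, lin_span S v -> P v.
Proof.
move=> P0 PL PS v [n [c [s [sS ->]]]].
by apply: (big_rec P) => // i y _ Py; apply: PL => //; apply: PS.
Qed.

End LinSpan.

Lemma lin_span_bilinear (K : fieldType) (V W M : lmodType K)
    (b : {bilinear V -> W -> M}) (S : V -> Prop) (S' : W -> Prop) (P : M -> Prop) :
  P 0 -> (forall c v w, P v -> P w -> P (c *: v + w)) ->
  (forall v w, S v -> S' w -> P (b v w)) ->
  forall v w, lin_span S v -> lin_span S' w -> P (b v w).
Proof.
move=> P0 PL PS v w Sv S'w; move: v Sv; apply: lin_span_ind => [|c v v' hv hv'|v Sv].
- by rewrite linear0l.
- by rewrite linearPl; apply: PL.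
move: w S'w; apply: lin_span_ind => [|c w w' hw hw'|w S'w].
- by rewrite linear0r.
- by rewrite linearPr; apply: PL.
exact: PS.
Qed.

Section Centre.
Variables (K : numClosedFieldType) (r : nat) (alpha : 'I_r -> K).
Hypotheses (r_gt0 : (0 < r)%N) (alpha_neq0 : forall i, alpha i != 0).
Local Notation p := (hyper_poly alpha).
Local Notation a := (fun k => p`_k).
Variables (R : comUnitAlgType K) (t u : R) (hR : is_hyper_ring p t u).
Variables (Om : lmodType R) (d : R -> Om) (hd : is_kaehler d).
Variables (H : lmodType K) (cls : Om -> H) (hcls : is_mod_exact d cls).
Local Notation w := (om t u d cls).
Local Notation ecls := (ecls t d cls).
Local Notation ocls := (ocls t u d cls).

Let p1 := hyper_poly_coef1 alpha_neq0.
Let pr := hyper_poly_lead alpha.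

Lemma om0E : w 0 = ecls (-1). Proof. by rewrite /om /ecls exprN1. Qed.
Lemma omSE k : w k.+1 = ocls (- k.+1%:Z). Proof. by []. Qed.

(** The dual basis of the [omega_k], from the sequences [delta_(n, -1)] and
    [ocoef m]. *)
Lemma om_dual m : (m <= r)%N -> exists th : {linear H -> K^o},
  forall k, (k <= r)%N -> th (w k) = (k == m)%:R.
Proof.
move=> mr.
pose le (n : int) : K := ((n == -1) && (m == 0%N))%:R.
pose lo (n : int) : K := if m == 0%N then 0 else ocoef alpha m n.
have [||th [the tho]] := @hyper_functional _ _ _ _ _ _ hR _ _ hd _ _ hcls le lo.
- by move=> n n1; rewrite /le (negPf n1).
- move=> i; rewrite /lo; case: eqVneq => [_|m0].
    by rewrite big1// => j _; rewrite mulr0.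
  exact: ocoef_rec.
exists th => -[|k] kr; first by rewrite om0E the /le eqxx eq_sym.
rewrite omSE tho /lo; case: eqVneq => [->|m0]; first by [].
rewrite ocoef_base; last by lia.
by rewrite eqr_opp.
Qed.

Lemma om_indep (c : 'I_r.+1 -> K) : \sum_(k < r.+1) c k *: w k = 0 -> forall k, c k = 0.
Proof.
move=> c0 m; have [|th thE] := @om_dual m; first by rewrite -ltnS.
have := congr1 th c0; rewrite linear_sum linear0 (bigD1 m)//= big1 => [|k km].
  by rewrite addr0 linearZ /= thE ?eqxx -1?ltnS// => <-; rewrite [RHS]mulr1.
by rewrite linearZ /= thE -1?ltnS// (negPf (km : k != m :> nat)) scaler0.
Qed.

(** Both sides satisfy the recurrence, and they agree for [-r <= n < 0]. *)
Lemma ocls_expand n : ocls n = \sum_(1 <= k < r.+1) ocoef alpha k n *: w k.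
Proof.
apply/eqP; rewrite -subr_eq0; apply/eqP; move: n.
apply: (@ocls_unique K r alpha H (fun n => ocls n - _) p1 pr) => [i|n nr].
  under eq_bigr => j _ do rewrite scalerBr scaler_sumr.
  rewrite sumrB (ocls_rec hR hd hcls) exchange_big big1 ?subr0//= => k _.
  under eq_bigr => j _ do rewrite scalerA.
  by rewrite -scaler_suml ocoef_rec// scale0r.
have [k kE] : exists k, n = - k.+1%:Z by exists (absz (n + 1)); lia.
have kr : (0 < k.+1 < r.+1)%N by lia.
rewrite (bigD1_seq k.+1) ?mem_index_iota ?iota_uniq//= big_nat_cond big1; last first.
  move=> j /andP[/andP[j1 j2] jk]; rewrite ocoef_base// kE eqr_opp.
  by rewrite eqz_nat eq_sym (negPf jk) scale0r.
by rewrite ocoef_base// kE eqxx scale1r addr0 subrr.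
Qed.

(** The case distinction in [psi] is the one between the two halves of the
    sequence [ocoef]. *)
Lemma psiE i j : psi r a w i j = ocls (i + j - 1).
Proof.
rewrite ocls_expand /psi /ocoef.
have -> : (- r%:Z <= i + j - 1) = (1 - r%:Z <= i + j) by apply/idP/idP; lia.
have -> : 1 - i - j = - (i + j - 1) by lia.
by case: ifP.
Qed.

Definition om_even h := exists c : K, h = c *: w 0.
Definition om_odd h := exists c : nat -> K, h = \sum_(1 <= k < r.+1) c k *: w k.

Lemma om_even_lin c h h' : om_even h -> om_even h' -> om_even (c *: h + h').
Proof. by move=> [b ->] [b' ->]; exists (c * b + b'); rewrite scalerDl scalerA. Qed.

Lemma om_odd_lin c h h' : om_odd h -> om_odd h' -> om_odd (c *: h + h').
Proof.
move=> [b ->] [b' ->]; exists (fun k => c * b k + b' k).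
rewrite scaler_sumr -big_split; apply: eq_bigr => k _ /=.
by rewrite scalerDl scalerA.
Qed.

Lemma om_even0 : om_even 0. Proof. by exists 0; rewrite scale0r. Qed.
Lemma om_odd0 : om_odd 0.
Proof. by exists (fun=> 0); rewrite big1// => k _; rewrite scale0r. Qed.

Lemma om_even_ecls n : om_even (ecls n).
Proof.
have [->|n1] := eqVneq n (-1); first by exists 1; rewrite om0E scale1r.
by rewrite (ecls_eq0 hR hd hcls n1); apply: om_even0.
Qed.

Lemma om_odd_ocls n : om_odd (ocls n).
Proof. by exists (fun k => ocoef alpha k n); apply: ocls_expand. Qed.

Lemma om_evenZ c h : om_even h -> om_even (c *: h).
Proof. by move=> hh; rewrite -[_ *: _]addr0; apply: om_even_lin => //; apply: om_even0. Qed.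
Lemma om_oddZ c h : om_odd h -> om_odd (c *: h).
Proof. by move=> hh; rewrite -[_ *: _]addr0; apply: om_odd_lin => //; apply: om_odd0. Qed.

Lemma cls_tt_even i j : om_even (cls (t ^ i *: d (t ^ j))).
Proof. by rewrite (cls_tt hR hd hcls); apply/om_evenZ/om_even_ecls. Qed.
Lemma cls_ut_odd i j : om_odd (cls ((t ^ i * u) *: d (t ^ j))).
Proof. by rewrite (cls_ut hR hd hcls); apply/om_oddZ/om_odd_ocls. Qed.
Lemma cls_tu_odd i j : om_odd (cls (t ^ i *: d (t ^ j * u))).
Proof.
by rewrite (cls_anti hd hcls) -scaleN1r; apply/om_oddZ/cls_ut_odd.
Qed.
Lemma cls_uu_even i j : om_even (cls ((t ^ i * u) *: d (t ^ j * u))).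
Proof.
rewrite (cls_uu hR hd hcls); apply: (big_rec om_even) => [|k x _ hx].
  exact: om_even0.
by apply: om_even_lin => //; apply: om_even_ecls.
Qed.

Lemma om_decomp h : exists h0 h1, [/\ om_even h0, om_odd h1 & h = h0 + h1].
Proof.
have [cl cr] := cls_bilinear hd hcls.
have closed c x y : (exists h0 h1, [/\ om_even h0, om_odd h1 & x = h0 + h1]) ->
    (exists h0 h1, [/\ om_even h0, om_odd h1 & y = h0 + h1]) ->
    exists h0 h1, [/\ om_even h0, om_odd h1 & c *: x + y = h0 + h1].
  move=> [x0 [x1 [e0 o1 ->]]] [y0 [y1 [e0' o1' ->]]].
  exists (c *: x0 + y0), (c *: x1 + y1); split; [exact: om_even_lin|exact: om_odd_lin|].
  by rewrite scalerDr addrACA.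
have ev x : om_even x -> exists h0 h1, [/\ om_even h0, om_odd h1 & x = h0 + h1].
  by move=> hx; exists x, 0; split=> //; [apply: om_odd0|rewrite addr0].
have od x : om_odd x -> exists h0 h1, [/\ om_even h0, om_odd h1 & x = h0 + h1].
  by move=> hx; exists 0, x; split=> //; [apply: om_even0|rewrite add0r].
move: h; apply: (mod_exact_ind hd hcls) => [//|x y].
move: x; apply: (hyper_ind hR) => [c x x' hx hx'|i|i].
- by rewrite cl; apply: closed.
- move: y; apply: (hyper_ind hR) => [c x x' hx hx'|j|j].
  + by rewrite cr; apply: closed.
  + exact/ev/cls_tt_even.
  + exact/od/cls_tu_odd.
- move: y; apply: (hyper_ind hR) => [c x x' hx hx'|j|j].
  + by rewrite cr; apply: closed.
  + exact/od/cls_ut_odd.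
  + exact/ev/cls_uu_even.
Qed.

Lemma om_even_odd0 h : om_even h -> om_odd h -> h = 0.
Proof.
move=> [c ->] [b]; have [th thE] := om_dual (leq0n r).
move=> /(congr1 th); rewrite linearZ_LR linear_sum thE// big_nat_cond big1.
  by rewrite eqxx [_ *: _]mulr1 => ->; rewrite scale0r.
move=> k /andP[/andP[k1 kr] _]; rewrite linearZ_LR thE//.
by rewrite -(prednK k1) scaler0.
Qed.

Section Graded.
Variables (g : vectType K) (br : {bilinear g -> g -> g}).
Variables (T : lmodType K) (tens : {bilinear g -> R -> T}).
Variables (brT : {bilinear T -> T -> T}) (hT : is_current_lie br tens brT).
Variable Phi : {bilinear T -> T -> H}.
Hypothesis PhiE : forall x b y c,
  Phi (tens x b) (tens y c) = killing br x y *: cls (b *: d c).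
Variable brh : {bilinear (T * H)%type -> (T * H)%type -> (T * H)%type}.
Hypothesis brhE : forall z z', brh z z' = (brT z.1 z'.1, Phi z.1 z'.1).

Let hTens : is_tensor_product tens. Proof. by case: hT. Qed.
Let brTE x y b c : brT (tens x b) (tens y c) = tens (br x y) (b * c).
Proof. by case: hT. Qed.
Let tU : t \is a GRing.unit. Proof. by case: hR. Qed.

Local Notation S0 := (fun v => exists x (i : int), v = tens x (t ^ i)).
Local Notation S1 := (fun v => exists x (i : int), v = tens x (t ^ i * u)).
Local Notation T0 := (lin_span S0).
Local Notation T1 := (lin_span S1).

Lemma span_decomp X : exists X0 X1, [/\ T0 X0, T1 X1 & X = X0 + X1].
Proof.
have closed c x y : (exists h0 h1, [/\ T0 h0, T1 h1 & x = h0 + h1]) ->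
    (exists h0 h1, [/\ T0 h0, T1 h1 & y = h0 + h1]) ->
    exists h0 h1, [/\ T0 h0, T1 h1 & c *: x + y = h0 + h1].
  move=> [x0 [x1 [e0 o1 ->]]] [y0 [y1 [e0' o1' ->]]].
  exists (c *: x0 + y0), (c *: x1 + y1); split; [exact: lin_span_lin|exact: lin_span_lin|].
  by rewrite scalerDr addrACA.
move: X; apply: (tensor_ind hTens) => // x b.
move: b; apply: (hyper_ind hR) => [c b b' hb hb'|i|i].
- by rewrite linearPr; apply: closed.
- exists (tens x (t ^ i)), 0; split; last by rewrite addr0.
    by apply: lin_span_gen; exists x, i.
  exact: lin_span0.
- exists 0, (tens x (t ^ i * u)); split; last by rewrite add0r.
    exact: lin_span0.
  by apply: lin_span_gen; exists x, i.
Qed.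

(** The automorphism of [R] fixing [t] and negating [u] acts on the even part as
    [1] and on the odd part as [-1]. *)
Lemma span_inter0 X : T0 X -> T1 X -> X = 0.
Proof.
have [_ u2 univ] := hR.
have [||s [st su _]] := univ R t t^-1 (- u); rewrite ?mulrV ?sqrrN//.
have sti i : s (t ^ i) = t ^ i by rewrite rmorphXz//= st.
have [|tau tauE] := @tensor_lift _ _ _ _ _ hTens T (fun x b => tens x (s b)).
  by split=> z c x y /=; rewrite ?linearP ?linearPl ?linearPr.
have tau0 : T0 X -> tau X = X.
  move: X; apply: lin_span_ind => [|c v v' hv hv'|_ [x [i ->]]].
  - by rewrite linear0.
  - by rewrite linearP hv hv'.
  - by rewrite tauE sti.
have tau1 : T1 X -> tau X = - X.
  move: X {tau0}; apply: lin_span_ind => [|c v v' hv hv'|_ [x [i ->]]].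
  - by rewrite linear0 oppr0.
  - by rewrite linearP hv hv' opprD scalerN.
  - by rewrite tauE rmorphM /= sti su mulrN linearNr.
by move=> /tau0 e0 /tau1 e1; apply: eq_opp_eq0; rewrite -e1 e0.
Qed.

Lemma tens_hyper x n :
  tens x (t ^ n * horner_alg t p) = \sum_(1 <= k < r.+2) p`_k *: tens x (t ^ (n + k%:Z)).
Proof.
by rewrite (texp_hyper hR) linear_sumr; apply: eq_bigr => k _; rewrite linearZr_LR.
Qed.

Lemma ghat_graded :
  Z2_graded brh (ghat0 t u d cls tens) (ghat1 t u d cls tens r).
Proof.
have tt i j : t ^ i * t ^ j = t ^ (i + j) by rewrite exprzDr.
have u2 : u * u = horner_alg t p by case: hR => _ <-.
have T0P x i : T0 (tens x (t ^ i)) by apply: lin_span_gen; exists x, i.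
have T1P x i : T1 (tens x (t ^ i * u)) by apply: lin_span_gen; exists x, i.
have T0_0 := lin_span0 S0; have T1_0 := lin_span0 S1.
have T0_l := @lin_span_lin _ _ S0; have T1_l := @lin_span_lin _ _ S1.
have E0 := om_even0; have E1 := om_odd0.
split.
- by move=> c x y [x1 x2] [y1 y2]; split; [apply: lin_span_lin|apply: om_even_lin].
- by move=> c x y [x1 x2] [y1 y2]; split; [apply: lin_span_lin|apply: om_odd_lin].
- move=> [X h]; have [X0 [X1 [t0 t1 ->]]] := span_decomp X.
  have [h0 [h1 [e0 e1 ->]]] := om_decomp h.
  by exists (X0, h0), (X1, h1); split.
- move=> [X h] [/= t0 e0] [/= t1 e1].
  by rewrite (span_inter0 t0 t1) (om_even_odd0 e0 e1).
split=> -[X h] [Y k] [/= tX _] [/= tY _]; rewrite brhE /=; split=> /=.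
- apply: (lin_span_bilinear T0_0 T0_l _ tX tY) => _ _ [x [i ->]] [y [j ->]].
  by rewrite brTE tt.
- apply: (lin_span_bilinear E0 om_even_lin _ tX tY) => _ _ [x [i ->]] [y [j ->]].
  by rewrite PhiE; apply/om_evenZ/cls_tt_even.
- apply: (lin_span_bilinear T1_0 T1_l _ tX tY) => _ _ [x [i ->]] [y [j ->]].
  by rewrite brTE mulrA tt.
- apply: (lin_span_bilinear E1 om_odd_lin _ tX tY) => _ _ [x [i ->]] [y [j ->]].
  by rewrite PhiE; apply/om_oddZ/cls_tu_odd.
- apply: (lin_span_bilinear T1_0 T1_l _ tX tY) => _ _ [x [i ->]] [y [j ->]].
  by rewrite brTE mulrAC tt.
- apply: (lin_span_bilinear E1 om_odd_lin _ tX tY) => _ _ [x [i ->]] [y [j ->]].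
  by rewrite PhiE; apply/om_oddZ/cls_ut_odd.
- apply: (lin_span_bilinear T0_0 T0_l _ tX tY) => _ _ [x [i ->]] [y [j ->]].
  rewrite brTE mulrACA tt u2 tens_hyper.
  by apply: (big_rec T0) => // n z _ hz; apply: lin_span_lin.
- apply: (lin_span_bilinear E0 om_even_lin _ tX tY) => _ _ [x [i ->]] [y [j ->]].
  by rewrite PhiE; apply/om_evenZ/cls_uu_even.
Qed.

End Graded.

End Centre.

Theorem theorem5p1 (RR : realType) (r : nat) (hr : (1 <= r)%N)
    (alpha : 'I_r -> RR[i]) (alpha_inj : injective alpha)
    (alpha_neq0 : forall i, alpha i != 0)
    (* R = C[t^{+-1}, u : u^2 = p(t)] *)
    (R : comUnitAlgType RR[i]) (t u : R)
    (hR : is_hyper_ring (hyper_poly alpha) t u)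
    (* (Omega_R, d), and H = Omega_R / dR *)
    (Om : lmodType R) (d : R -> Om) (hd : is_kaehler d)
    (H : lmodType RR[i]) (cls : Om -> H) (hcls : is_mod_exact d cls)
    (* g, and T = g (x) R *)
    (g : vectType RR[i]) (br : {bilinear g -> g -> g}) (hg : simple_lie br)
    (T : lmodType RR[i]) (tens : {bilinear g -> R -> T})
    (brT : {bilinear T -> T -> T}) (hT : is_current_lie br tens brT) :
  let a : nat -> RR[i] := fun k => (hyper_poly alpha)`_k in
  let p_t : R := horner_alg t (hyper_poly alpha) in
  let w : nat -> H := om t u d cls in
  (forall c : 'I_r.+1 -> RR[i],
      \sum_(k < r.+1) c k *: w k = 0 -> forall k, c k = 0) /\
  exists brh : {bilinear (T * H)%type -> (T * H)%type -> (T * H)%type},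
    [/\ universal_central_extension brT brh (fst : {linear (T * H)%type -> T}),
        Z2_graded brh (ghat0 t u d cls tens) (ghat1 t u d cls tens r),
        forall (k : 'I_r.+1) z, brh (0, w k) z = 0 &
        [/\ forall x y (i j : int),
              brh (tens x (t ^ i), 0) (tens y (t ^ j), 0) =
              (tens (br x y) (t ^ (i + j)),
               ((i + j == 0)%:R * j%:~R * killing br x y) *: w 0%N),
            forall x y (i j : int),
              brh (tens x (t ^ i * u), 0) (tens y (t ^ j * u), 0) =
              (tens (br x y) (t ^ (i + j) * p_t),
               (killing br x y *
                \sum_(1 <= k < r.+2)
                  (j%:~R + 2^-1 * k%:R) * a k * (i + j == - k%:Z)%:R) *: w 0%N) &
            forall x y (i j : int),
              brh (tens x (t ^ i * u), 0) (tens y (t ^ j), 0) =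
              (tens (br x y) (t ^ (i + j) * u),
               (j%:~R * killing br x y) *: psi r a w i j)]].
Proof.
move=> a p_t w; split; first exact: om_indep.
have tU : t \is a GRing.unit by case: hR.
have u2 : u * u = p_t by rewrite /p_t; case: hR => _ <-.
have brTE x y b c : brT (tens x b) (tens y c) = tens (br x y) (b * c) by case: hT.
have [Phi [PhiE Panti Pcoc]] := current_cocycle hg hT hd hcls.
have [|brh brhE] := @bilinear_map RR[i] (T * H)%type (T * H)%type (T * H)%type
    (fun z z' => (brT z.1 z'.1, Phi z.1 z'.1)).
  by split=> z c z1 z2 /=; rewrite ?linearPl ?linearPr.
have w0E n : ecls t d cls n = (n == -1)%:R *: w 0%N.
  have [->|n1] := eqVneq n (-1); first by rewrite scale1r /w om0E.
  by rewrite scale0r (ecls_eq0 hR hd hcls).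
exists brh; split.
- exact: (kassel hg hT hd hcls PhiE Panti Pcoc brhE).
- exact: (ghat_graded hr alpha_neq0 hR hd hcls hT PhiE brhE).
- by move=> k z; rewrite brhE !linear0l.
split=> x y i j; rewrite brhE /= brTE PhiE.
- rewrite -exprzDr// (cls_tt hR hd hcls) w0E !scalerA; congr (_, _ *: _).
  have -> : (i + j - 1 == -1) = (i + j == 0) by apply/idP/idP; lia.
  by ring.
- rewrite mulrACA -exprzDr// u2 (cls_uu hR hd hcls) -scalerA; congr (_, _ *: _).
  rewrite scaler_suml; apply: eq_bigr => k _; rewrite w0E scalerA.
  by have -> : (i + j + k%:Z - 1 == -1) = (i + j == - k%:Z) by apply/idP/idP; lia.
- rewrite mulrAC -exprzDr// (cls_ut hR hd hcls) psiE//.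
  by rewrite scalerA [killing _ _ _ * _]mulrC.
Qed.
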